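(* For every finite alphabet $\Sigma$, $\mathbf{LMO}(\Sigma)=V_\Sigma(\overline{\mathbf{J}})=\mathrm{liId}\mathbf{PT}(\Sigma)$.
   Context: A MON-1qfa over $\Sigma$ is a tuple $A=\langle\Sigma\cup\{\#\},(O_c)_{c\in\Sigma\cup\{\#\}},\pi_0,F\rangle$, where $\pi_0\in\mathbb{C}^{1\times m}$ has norm $1$, each $O_c$ is an observable (Hermitian $m\times m$ matrix) with spectral decomposition $O_c=\sum_{r\in V(O_c)} r\,P_c(r)$ into orthogonal projectors, and $F\subseteq V(O_\#)$. For $x=x_1\cdots x_n$, with $\rho_0=\pi_0^\dagger\pi_0$ and $\rho_i=\sum_{r}P_{x_i}(r)\rho_{i-1}P_{x_i}(r)$, the acceptance probability is $p_A(x)=\sum_{r\in F}\mathrm{tr}(P_\#(r)\rho_n)$. $A$ recognizes $L$ with isolated cut-point $\lambda$ if for all $x$, $x\in L\Leftrightarrow p_A(x)>\lambda$, and there is $\delta>0$ with $|p_A(x)-\lambda|\ge\delta$ for all $x$. $\mathbf{LMO}(\Sigma)$ is the class of languages over $\Sigma$ recognized by some MON-1qfa with isolated cut-point. $V_\Sigma(\overline{\mathbf{J}})$ is the class of regular languages $L\subseteq\Sigma^*$ whose syntactic monoid $M(L)$ is $J$-trivial ($MxM=MyM\Rightarrow x=y$) and whose syntactic morphism $\phi_L:\Sigma^*\to M(L)$ satisfies $\phi_L(\sigma)^2=\phi_L(\sigma)$ for all $\sigma\in\Sigma$. $\mathrm{liId}\mathbf{PT}(\Sigma)$ (literally idempotent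 piecewise testable languages) is the boolean closure in $\Sigma^*$ of the languages $\Sigma^*a_1\Sigma^*a_2\Sigma^*\cdots\Sigma^*a_k\Sigma^*$ with $a_1,\dots,a_k\in\Sigma$ and $a_i\ne a_{i+1}$ for all $1\le i<k$. *)

(* Defs.v *)
From HB Require Import structures.
From mathcomp Require Import all_boot all_order all_algebra.
From mathcomp Require Import complex.
From mathcomp Require Import reals Rstruct.
Set Implicit Arguments. Unset Strict Implicit. Unset Printing Implicit Defensive.
Import Order.TTheory GRing.Theory Num.Theory.
Local Open Scope ring_scope.

Definition C : numClosedFieldType := (Rdefinitions.R)[i].

Definition adjmx (m n : nat) (A : 'M[C]_(m, n)) : 'M[C]_(n, m) :=
  (map_mx Num.conj A)^T.

(** An observable (Hermitian m x m matrix) together with its spectral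
    decomposition O = sum_{r in V(O)} r P(r): [obs_spec] lists the pairs
    (r, P(r)), r ranging over the (distinct) eigenvalues V(O), the P(r) being
    nonzero orthogonal projectors, pairwise orthogonal and summing to 1.
    (The spectral decomposition of a Hermitian matrix is unique, so this data
    is determined by the matrix [obs_mx].) *)
Record observable (m : nat) := Observable {
  obs_mx : 'M[C]_m;
  obs_spec : seq (C * 'M[C]_m);
  obs_herm : adjmx obs_mx = obs_mx;
  obs_uniq : uniq (map fst obs_spec);
  obs_proj : forall rp, rp \in obs_spec ->
      [/\ rp.2 *m rp.2 = rp.2, adjmx rp.2 = rp.2 & rp.2 != 0];
  obs_orth : forall rp rq, rp \in obs_spec -> rq \in obs_spec ->
      rp.1 != rq.1 -> rp.2 *m rq.2 = 0;
  obs_sum : \sum_(rp <- obs_spec) rp.2 = 1%:M;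
  obs_dec : obs_mx = \sum_(rp <- obs_spec) rp.1 *: rp.2 }.

Definition spectrum m (O : observable m) : seq C := map fst (obs_spec O).

(** A MON-1qfa over Sigma; the end-marker # is [None : option Sigma]. *)
Record mon1qfa (Sigma : finType) := Mon1qfa {
  qdim : nat;
  qinit : 'rV[C]_qdim;
  qinit_norm : \sum_(i < qdim) `|qinit 0 i| ^+ 2 = 1;
  qobs : option Sigma -> observable qdim;
  qacc : seq C;
  qacc_sub : {subset qacc <= spectrum (qobs None)} }.

Definition measure m (O : observable m) (rho : 'M[C]_m) : 'M[C]_m :=
  \sum_(rp <- obs_spec O) (rp.2 *m rho *m rp.2).

Definition rho0 Sigma (A : mon1qfa Sigma) : 'M[C]_(qdim A) :=
  adjmx (qinit A) *m qinit A.

Definition rho_word Sigma (A : mon1qfa Sigma) (x : seq Sigma) : 'M[C]_(qdim A) :=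
  foldl (fun rho c => measure (qobs A (Some c)) rho) (rho0 A) x.

Definition accprob Sigma (A : mon1qfa Sigma) (x : seq Sigma) : C :=
  \sum_(rp <- obs_spec (qobs A None) | rp.1 \in qacc A)
     \tr (rp.2 *m rho_word A x).

Definition language (Sigma : finType) := seq Sigma -> Prop.

Definition recognizes_isolated Sigma (A : mon1qfa Sigma) (L : language Sigma) :=
  exists lambda : C, lambda \is Num.real /\
    (forall x, L x <-> lambda < accprob A x) /\
    exists2 delta : C, 0 < delta & forall x, delta <= `|accprob A x - lambda|.

Definition LMO (Sigma : finType) (L : language Sigma) : Prop :=
  exists A : mon1qfa Sigma, recognizes_isolated A L.

Definition regular (Sigma : finType) (L : language Sigma) : Prop :=
  exists (Q : finType) (q0 : Q) (d : Q -> Sigma -> Q) (F : pred Q),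
    forall w, L w <-> F (foldl d q0 w).

(** Syntactic congruence; the syntactic monoid M(L) is Sigma^* modulo it,
    and phi_L maps a word to its class. *)
Definition syn_eq (Sigma : finType) (L : language Sigma) (u v : seq Sigma) :=
  forall x y, L (x ++ u ++ y) <-> L (x ++ v ++ y).

(** M(L) is J-trivial: M[u]M = M[v]M implies [u] = [v]
    (the class [w] lies in M[u]M iff [w] = [a u b] for some words a b). *)
Definition synJtrivial (Sigma : finType) (L : language Sigma) : Prop :=
  forall u v : seq Sigma,
    (forall w, (exists a b, syn_eq L w (a ++ u ++ b)) <->
               (exists c d, syn_eq L w (c ++ v ++ d))) ->
    syn_eq L u v.

Definition VJbar (Sigma : finType) (L : language Sigma) : Prop :=
  [/\ regular L, synJtrivial L &
      forall s : Sigma, syn_eq L [:: s; s] [:: s]].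

Definition no_consec (Sigma : finType) (s : seq Sigma) : bool :=
  if s is a :: t then path (fun x y => x != y) a t else true.

(** Boolean closure of the languages Sigma^* a1 Sigma^* ... Sigma^* ak Sigma^*
    (= words having a1...ak as a scattered subword), a_i != a_{i+1}. *)
Inductive liIdPT_gen (Sigma : finType) : language Sigma -> Prop :=
  | lipt_base (s : seq Sigma) : no_consec s ->
      liIdPT_gen (fun w => subseq s w)
  | lipt_compl L : liIdPT_gen L -> liIdPT_gen (fun w => ~ L w)
  | lipt_union L1 L2 : liIdPT_gen L1 -> liIdPT_gen L2 ->
      liIdPT_gen (fun w => L1 w \/ L2 w)
  | lipt_inter L1 L2 : liIdPT_gen L1 -> liIdPT_gen L2 ->
      liIdPT_gen (fun w => L1 w /\ L2 w).

Definition liIdPT (Sigma : finType) (L : language Sigma) : Prop :=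
  exists2 L' : language Sigma, liIdPT_gen L' & forall w, L w <-> L' w.

(* Main.v *)
Require Import Defs.
From HB Require Import structures.
From mathcomp Require Import all_boot all_order all_algebra.
From mathcomp Require Import cyclic separable cyclotomic.
From mathcomp Require Import complex reals Rstruct.
From mathcomp Require Import boolp zify ring.
Set Implicit Arguments. Unset Strict Implicit. Unset Printing Implicit Defensive.

(** The three classes are compared cyclically.

    LMO in V(J): the superoperator of a measurement is an orthogonal projection
    of the Hilbert space of matrices, so p(x) = <xi, P_x eta> for products P_x
    of orthogonal projections. Vectors close to each other are not separated by
    an isolated cut-point, and boundedness gives finitely many Nerode classes.
    The Frobenius norm of P_w^n is nonincreasing in n, hence some step loses
    almost nothing; by Pythagoras P_w^n is then almost fixed by every letter of
    w. If v = a u b and u = c v d in M(L), then u = (ca)^n u (bd)^n for all n,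
    and absorbing a and b for a suitable n gives u = a u b = v.

    V(J) in liIdPT: Simon's theorem. Words with the same subwords of length
    at most n have a common superword with the same property, so it suffices to
    insert one letter, x y -> x a y; half of the length is then available for
    x -> x a or y -> a y, which is trivial in M(L) since a strict descent in the
    R-order (resp. L-order) is bounded by the size of M(L). Repeating each
    letter k times, which idempotence allows, turns arbitrary subwords of
    length at most k into subwords without equal consecutive letters.

    liIdPT in LMO: measuring in a basis unbiased with respect to the canonical
    one on each block of a partition (a Fourier basis) averages a diagonal
    state over the blocks. Products of such classical averaging automata give
    boolean combinations. For the word a_1 ... a_k take levels 0, ..., k of
    sizes M^i and let a letter b merge the levels i - 1 and i whenever a_i = b:
    no mass reaches level k before a_1 ... a_k has been read as a subword, and
    almost all of it stays there afterwards if M is large. *)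

(** * Simon's theorem *)

Section Subsequences.
Variable T : eqType.
Implicit Types (r s u v w x y z : seq T) (a b c : T).

Lemma subseq_catP r x y :
  reflect (exists r1 r2, [/\ r = r1 ++ r2, subseq r1 x & subseq r2 y])
          (subseq r (x ++ y)).
Proof.
apply: (iffP idP); last by case=> r1 [r2 [-> h1 h2]]; exact: cat_subseq.
elim: x r => [|c x IH] r /=; first by exists [::], r; split.
case: r => [|a r]; first by exists [::], [::]; rewrite !sub0seq.
case: eqP => [->|ne] /IH [r1 [r2 [e h1 h2]]].
  by exists (c :: r1), r2; rewrite e /= eqxx; split.
exists r1, r2; split => //; apply: subseq_trans h1 (subseq_cons _ _).
Qed.

Lemma subseq_insert r x y a :
  subseq r (x ++ a :: y) -> ~~ subseq r (x ++ y) ->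
  exists r1 r2, [/\ r = r1 ++ a :: r2, subseq r1 x & subseq r2 y].
Proof.
move=> /subseq_catP [r1 [[|c r2] [-> h1 h2]]] nh.
  by rewrite cats0 (subseq_trans h1 (prefix_subseq _ _)) in nh.
move: h2 nh => /=; case: eqP => [->|_] h2 nh; first by exists r1, r2.
by rewrite cat_subseq in nh.
Qed.

(** The part of the subword placed inside x either stops before the letter a or contains
    [rcons r1 a]. *)
Lemma subseq_split r1 a r2 x y :
  subseq (r1 ++ a :: r2) (x ++ y) -> subseq (rcons r1 a) x \/ subseq (a :: r2) y.
Proof.
move=> /subseq_catP [p [q [e hp hq]]].
have [le|lt] := leqP (size p) (size r1).
  right; apply: subseq_trans hq.
  have -> : q = drop (size p) (r1 ++ a :: r2) by rewrite e drop_size_cat.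
  have -> : drop (size p) (r1 ++ a :: r2) = drop (size p) r1 ++ a :: r2.
    rewrite drop_cat; case: ifP => // /negbT; rewrite -leqNgt => ge.
    have e1 : size p = size r1 by lia.
    by rewrite e1 subnn drop_size.
  exact: suffix_subseq.
left; apply: subseq_trans hp.
have -> : rcons r1 a = take (size r1).+1 p.
  have -> : take (size r1).+1 p = take (size r1).+1 (p ++ q).
    rewrite take_cat; case: ifP => // /negbT; rewrite -leqNgt => ge.
    have e1 : (size r1).+1 = size p by lia.
    by rewrite e1 subnn take0 cats0 take_size.
  by rewrite -e -cat_rcons take_cat size_rcons ltnn subnn take0 cats0.
exact: take_subseq.
Qed.

Lemma subseq_rcons_neq s x a b :
  a != b -> subseq (rcons s a) (rcons x b) -> subseq (rcons s a) x.
Proof.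
move=> ne; rewrite -subseq_rev !rev_rcons /= (negbTE ne) -rev_rcons.
by rewrite subseq_rev.
Qed.

Lemma subseq_consE r a y :
  subseq r (a :: y) ->
  exists r', [/\ subseq r' y, subseq r (a :: r') & size r' <= size r].
Proof.
case: r => [|c r] /=; first by exists [::]; rewrite sub0seq.
by case: eqP => _ h; [exists r | exists (c :: r)]; split.
Qed.

Definition simon_eq n u v :=
  forall r, size r <= n -> subseq r u = subseq r v.

Lemma simon_eqC n u v : simon_eq n u v -> simon_eq n v u.
Proof. by move=> h r hr; rewrite h. Qed.

Lemma simon_eq_trans n u v w :
  simon_eq n u v -> simon_eq n v w -> simon_eq n u w.
Proof. by move=> h1 h2 r hr; rewrite h1 // h2. Qed.

Lemma simon_eq_sandwich n u v w :
  subseq u v -> subseq v w -> simon_eq n u w -> simon_eq n u v.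
Proof.
move=> uv vw h r hr; apply/idP/idP => [/subseq_trans|]; first exact.
by move=> rv; rewrite h // (subseq_trans rv vw).
Qed.

Lemma subseq_cat_cons x a y : subseq (x ++ y) (x ++ a :: y).
Proof. by rewrite cat_subseq // subseq_cons. Qed.

(** A word telling the two sides apart has to use the inserted letter a, since x y is a subword of x
    a y. *)
Lemma simon_insertF n x a y : ~ simon_eq n (x ++ y) (x ++ a :: y) ->
  exists r1 r2, [/\ size (r1 ++ a :: r2) <= n, subseq r1 x, subseq r2 y
                  & ~~ subseq (r1 ++ a :: r2) (x ++ y)].
Proof.
move=> h; apply: contrapT => nex; apply: h => r hr.
apply/idP/idP => [h|h]; first exact: subseq_trans h (subseq_cat_cons _ _ _).
apply: contrapT => /negP nh; apply: nex.
by have [r1 [r2 [e h1 h2]]] := subseq_insert h nh; exists r1, r2; rewrite -e.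
Qed.

(** The word s1 a r2' is short enough to pass from x a y to x b z. As s1 a does not fit into x, and
    a differs from b, the rest a r2' fits into z. Then r1 b r2 is a subword of x b z, hence of x a
    y, against its choice. *)
Lemma simon_join_clash n x a b y z r1 r2 r2' s1 :
  a != b -> simon_eq n (x ++ a :: y) (x ++ b :: z) ->
  subseq r1 x -> subseq r2 (a :: r2') -> subseq r2' y ->
  size (r1 ++ b :: r2) <= n -> ~~ subseq (r1 ++ b :: r2) (x ++ a :: y) ->
  subseq s1 x -> ~~ subseq (rcons s1 a) x -> size (s1 ++ a :: r2') <= n -> False.
Proof.
move=> ne E h1 h2 h2' sz nsub hs1 ns1 sz2.
have : subseq (s1 ++ a :: r2') (x ++ a :: y) by rewrite cat_subseq //= eqxx.
rewrite E // -(cat_rcons b) => /subseq_split [].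
  by move=> /(subseq_rcons_neq ne) h; rewrite h in ns1.
move=> hz; move/negP: nsub; apply; rewrite E //.
by apply: cat_subseq => //=; rewrite eqxx; apply: subseq_trans h2 hz.
Qed.

(** If both insertions fail, their witnesses r1 b r2 and s1 a s2 can be crossed: the lengths of s1 a
    r2' and r1 b s2' add up to at most 2n, so one of these words has length at most n and
    [simon_join_clash] applies. *)
Lemma simon_join_step n x a b y z :
  a != b -> simon_eq n (x ++ a :: y) (x ++ b :: z) ->
  simon_eq n (x ++ a :: y) (x ++ b :: a :: y) \/
  simon_eq n (x ++ b :: z) (x ++ a :: b :: z).
Proof.
move=> ne E; apply: contrapT => /not_orP [/simon_insertF h /simon_insertF h'].
case: h => r1 [r2 [sr r1x r2y nr]]; case: h' => s1 [s2 [ss s1x s2z ns]].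
have [r2' [r2'y r2r szr]] := subseq_consE r2y.
have [s2' [s2'z s2s szs]] := subseq_consE s2z.
have nr1 : ~~ subseq (rcons r1 b) x.
  by apply: contra nr => h; rewrite -cat_rcons cat_subseq.
have ns1 : ~~ subseq (rcons s1 a) x.
  by apply: contra ns => h; rewrite -cat_rcons cat_subseq.
have [le|lt] := leqP (size (s1 ++ a :: r2')) n.
  exact: (simon_join_clash ne E r1x r2r r2'y sr nr s1x ns1 le).
apply: (simon_join_clash _ (simon_eqC E) s1x s2s s2'z ss ns r1x nr1).
  by rewrite eq_sym.
by move: sr ss lt szr szs; rewrite !size_cat /=; lia.
Qed.

Lemma simon_join n u v : simon_eq n u v ->
  exists f, [/\ subseq u f, subseq v f & simon_eq n u f].
Proof.
(* Both words are scanned behind a common prefix x. An inserted letter joins this prefix, so the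
   total length left to scan drops. *)
suff gen m x u' v' : size u' + size v' <= m ->
  simon_eq n (x ++ u') (x ++ v') ->
  exists f, [/\ subseq (x ++ u') f, subseq (x ++ v') f & simon_eq n (x ++ u') f].
  exact: (gen _ [::] u v (leqnn _)).
elim: m x u' v' => [|m IH] x [|a y] v' //= sz E;
  try solve [exfalso; lia | by rewrite cats0 in E *; exists (x ++ v'); rewrite prefix_subseq].
case: v' sz E => [|b z] /= sz E.
  by exists (x ++ a :: y); rewrite cats0 prefix_subseq.
have [eab|ne] := eqVneq a b.
  by rewrite -{b}eab -!(cat_rcons a x) in E *; apply: IH => //; lia.
have [h|h] := simon_join_step ne E.
  have [||f [h1 h2 h3]] := IH (rcons x b) (a :: y) z.
  - by move=> /=; lia.
  - by rewrite !cat_rcons; apply: simon_eq_trans E; apply: simon_eqC.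
  rewrite !cat_rcons in h1 h2 h3; exists f; split => //.
    exact: subseq_trans (subseq_cat_cons _ _ _) h1.
  exact: simon_eq_trans h h3.
have [||f [h1 h2 h3]] := IH (rcons x a) y (b :: z).
- by move=> /=; lia.
- by rewrite !cat_rcons; apply: simon_eq_trans h.
rewrite !cat_rcons in h1 h2 h3; exists f; split => //.
exact: subseq_trans (subseq_cat_cons _ _ _) h2.
Qed.

(** Witnesses r1 a and a s2 against the two alternatives glue to r1 a s2, of length below 2N, which
    x y must contain; [subseq_split] then places one of them where it cannot be. *)
Lemma simon_insert_half N x a y :
  simon_eq (N + N) (x ++ y) (x ++ a :: y) ->
  simon_eq N x (rcons x a) \/ simon_eq N y (a :: y).
Proof.
move=> E; apply: contrapT => /not_orP [].
rewrite -cats1 -{1}(cats0 x) => /simon_insertF [r1 [r2 [sr r1x]]].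
rewrite subseq0 => /eqP e; rewrite {r2}e in sr *; rewrite cats0 => nr.
move=> /(@simon_insertF N [::] a y) [s1 [s2 [ss]]]; rewrite subseq0.
move=> /eqP e; rewrite {s1}e in ss * => s2y /= ns.
have : subseq (r1 ++ a :: s2) (x ++ a :: y) by rewrite cat_subseq //= eqxx.
rewrite -E; last by move: sr ss; rewrite !size_cat /=; lia.
by move=> /subseq_split []; rewrite -?cats1; apply/negP.
Qed.

(** Minimality of the suffix c z among those containing all of B forces c to lie in B and not to
    recur in z. *)
Lemma shortest_suffix_cover (B x : seq T) : {subset B <= x} -> B != [::] ->
  exists x1 c z, [/\ x = x1 ++ c :: z, c \in B, c \notin z & {subset B <= c :: z}].
Proof.
elim: x => [|d x IH] sub nB.
  by case: B sub nB => // b B /(_ b); rewrite inE eqxx => /(_ isT).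
have [/allP h|/allPn [c cB nc]] := boolP (all (mem x) B).
  have [x1 [c [z [-> *]]]] := IH h nB.
  by exists (d :: x1), c, z.
have {}nc : c \notin x by [].
have := sub c cB; rewrite inE (negbTE nc) orbF => /eqP e; subst d.
by exists [::], c, x.
Qed.

(** * Strict descents in the R-order *)

Section RTrivial.
Variables (E : seq T -> seq T -> Prop) (F : finType) (tau : seq T -> F).
Hypothesis Esym : forall u v, E u v -> E v u.
Hypothesis Etrans : forall u v w, E u v -> E v w -> E u w.
Hypothesis Ecatr : forall u v w, E u v -> E (u ++ w) (v ++ w).
Hypothesis tauE : forall u v, tau u = tau v -> E u v.
Hypothesis Rtriv : forall u s t, E u (u ++ s ++ t) -> E u (u ++ s).

Lemma E_absorb x z : (forall b, b \in z -> E x (rcons x b)) -> E x (x ++ z).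
Proof.
elim/last_ind: z => [|z b IH] h; first by rewrite cats0; exact: tauE.
rewrite -rcons_cat; have xb := h b; rewrite mem_rcons mem_head in xb.
apply: Etrans (xb isT) _; rewrite -!cats1; apply: Ecatr; apply: IH => c cz.
by apply: h; rewrite mem_rcons inE cz orbT.
Qed.

(* Each factor of the decomposition of [x] either fixes its prefix or descends
   strictly in the R-order, so a move by [b] yields [l] strict descents. *)
Lemma R_chain l x (B : seq T) :
  (forall b, b \in B -> simon_eq l x (rcons x b)) ->
  (exists2 b, b \in B & ~ E x (rcons x b)) ->
  exists ps : seq (seq T), [/\ size ps = l.+1, uniq (map tau ps)
    & forall p, p \in ps -> exists q, x = p ++ q].
Proof.
elim: l x B => [|l IH] x B hB [b0 b0B nE].
  exists [:: x]; split => // p; rewrite inE => /eqP ->.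
  by exists [::]; rewrite cats0.
have sB : {subset B <= x}.
  by move=> b /hB /(_ [:: b]) /=; rewrite !sub1seq mem_rcons mem_head; exact.
have nB : B != [::] by case: B b0B {hB sB}.
have [x1 [c [z [ex cB cz sz]]]] := shortest_suffix_cover sB nB.
(* If r is a subword of x1 b, then r c is one of x c, hence of x = x1 c z. As c is not in z, r c
   already fits into x1 c, so r fits into x1. The extra letter costs one unit of length. *)
have hz b : b \in c :: z -> simon_eq l x1 (rcons x1 b).
  move=> bz r sr; apply/idP/idP => [h|h].
    by rewrite (subseq_trans h) ?subseq_rcons.
  have : subseq (rcons r c) (rcons x c).
    rewrite -!cats1 cat_subseq ?subseq_refl // ex.
    by apply: subseq_trans h _; rewrite -cats1 cat_subseq ?sub1seq.
  rewrite -hB // ?size_rcons // ex -cats1 -(cat_rcons c x1) => /subseq_split [].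
    by rewrite -subseq_rev !rev_rcons /= eqxx subseq_rev.
  by rewrite sub1seq (negbTE cz).
have [b bz nEb] : exists2 b, b \in c :: z & ~ E x1 (rcons x1 b).
  apply: contrapT => nex; apply: nE.
  have fx1 b : b \in c :: z -> E x1 (rcons x1 b).
    by move=> bz; apply: contrapT => nb; apply: nex; exists b.
  have Ex : E x1 x by rewrite ex; exact: E_absorb.
  apply: Etrans (Esym Ex) _; apply: Etrans (fx1 _ (sz _ b0B)) _.
  by rewrite -!cats1; apply: Ecatr.
have [ps [sps ups hps]] := IH _ _ hz (ex_intro2 _ _ b bz nEb).
exists (x :: ps); split => /=; first by rewrite sps.
  (* If x shared its value with a prefix p of x1, [Rtriv] would collapse all prefixes between p and
     x, and b would fix x1. *)
  rewrite ups andbT; apply/mapP => -[p pps /tauE Exp].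
  have [q e] := hps _ pps.
  have Ep1 : E p x1.
    by rewrite e; apply: (@Rtriv _ _ (c :: z)); rewrite catA -e -ex; apply: Esym.
  have Ex1 : E x1 x by apply: Etrans (Esym Ep1) (Esym Exp).
  apply: nEb; case/splitPr: bz ex => z1 z2 ex.
  have Ez1 : E x1 (x1 ++ z1) by apply: (@Rtriv _ _ (b :: z2)); rewrite -ex.
  have : E x1 (x1 ++ rcons z1 b).
    by apply: (@Rtriv _ _ z2); rewrite cat_rcons -ex.
  move/Etrans; apply; rewrite -rcons_cat -!cats1; apply: Ecatr; exact: Esym.
move=> p; rewrite inE => /orP [/eqP ->|/hps [q e]].
  by exists [::]; rewrite cats0.
by exists (q ++ c :: z); rewrite catA -e.
Qed.

Lemma R_absorb x a : simon_eq #|F| x (rcons x a) -> E x (rcons x a).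
Proof.
move=> h; apply: contrapT => nE.
have [||ps [sps ups _]] := @R_chain #|F| x [:: a].
- by move=> b; rewrite inE => /eqP ->.
- by exists a; rewrite ?inE.
have := max_card (mem (map tau ps)).
by rewrite (card_uniqP ups) size_map sps ltnn.
Qed.

End RTrivial.

Section Simon.
Variables (E : seq T -> seq T -> Prop) (F : finType) (tau : seq T -> F).
Hypothesis Esym : forall u v, E u v -> E v u.
Hypothesis Etrans : forall u v w, E u v -> E v w -> E u w.
Hypothesis Ecatr : forall u v w, E u v -> E (u ++ w) (v ++ w).
Hypothesis Ecatl : forall u v w, E u v -> E (w ++ u) (w ++ v).
Hypothesis tauE : forall u v, tau u = tau v -> E u v.
Hypothesis Rtriv : forall u s t, E u (u ++ s ++ t) -> E u (u ++ s).
Hypothesis Ltriv : forall u s t, E u (s ++ t ++ u) -> E u (t ++ u).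

Lemma L_absorb y a : simon_eq #|F| y (a :: y) -> E y (a :: y).
Proof.
move=> h.
have := @R_absorb (fun u v => E (rev u) (rev v)) F (tau \o rev) _ _ _ _ _ (rev y) a.
rewrite rev_rcons !revK; apply.
- by move=> u v; apply: Esym.
- by move=> u v w; apply: Etrans.
- by move=> u v w; rewrite !rev_cat; apply: Ecatl.
- by move=> u v; apply: tauE.
- by move=> u s t; rewrite !rev_cat -catA; apply: Ltriv.
by move=> r hr; rewrite -subseq_rev revK h ?size_rev // -rev_cons -(subseq_rev r) revK.
Qed.

Lemma E_insert x a y :
  simon_eq (#|F| + #|F|) (x ++ y) (x ++ a :: y) -> E (x ++ y) (x ++ a :: y).
Proof.
move=> /simon_insert_half [/(R_absorb Esym Etrans Ecatr tauE Rtriv)|/L_absorb].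
  by move=> h; rewrite -cat_rcons; apply: Ecatr.
exact: Ecatl.
Qed.

(** The missing letters of v are inserted one at a time; the intermediate words lie between u and v,
    so [simon_eq_sandwich] keeps them equivalent. *)
Lemma E_subseq u v : subseq u v -> simon_eq (#|F| + #|F|) u v -> E u v.
Proof.
suff gen w x : subseq w v -> simon_eq (#|F| + #|F|) (x ++ w) (x ++ v) ->
    E (x ++ w) (x ++ v) by exact: (gen u [::]).
elim: v w x => [|b v IH] w x; first by rewrite subseq0 => /eqP -> _; exact: tauE.
case: w => [|c w] /=.
  move=> _ h; have h1 := subseq_cat_cons x b v.
  have h0 : subseq (x ++ [::]) (x ++ v) by rewrite cat_subseq ?sub0seq.
  have h2 := simon_eq_sandwich h0 h1 h.
  apply: Etrans (IH [::] x (sub0seq _) h2) _; apply: E_insert.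
  exact: simon_eq_trans (simon_eqC h2) h.
case: eqP => [->|_] sub h.
  by rewrite -!(cat_rcons b x) in h *; apply: IH.
have h1 := subseq_cat_cons x b v.
have h0 : subseq (x ++ c :: w) (x ++ v) by rewrite cat_subseq.
have h2 := simon_eq_sandwich h0 h1 h.
apply: Etrans (IH _ x sub h2) _; apply: E_insert.
exact: simon_eq_trans (simon_eqC h2) h.
Qed.

Theorem simon u v : simon_eq (#|F| + #|F|) u v -> E u v.
Proof.
move=> h; have [f [uf vf hf]] := simon_join h.
apply: Etrans (E_subseq uf hf) _; apply: Esym; apply: E_subseq => //.
exact: simon_eq_trans (simon_eqC h) hf.
Qed.

End Simon.

End Subsequences.

(** * Subwords without equal consecutive letters *)

Section Destutter.
Variable T : finType.
Implicit Types (r s t u v w : seq T) (a b : T).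

Fixpoint destutter s :=
  if s is a :: t then
    if ohead (destutter t) == Some a then destutter t else a :: destutter t
  else [::].

Fixpoint strip b s :=
  if s is a :: t then if a == b then strip b t else s else [::].

Definition stretch k w := flatten [seq nseq k a | a <- w].

Lemma ohead_destutter a t : ohead (destutter (a :: t)) = Some a.
Proof. by rewrite /=; case: ifP => // /eqP. Qed.

Lemma size_destutter s : size (destutter s) <= size s.
Proof. by elim: s => //= a t IH; case: ifP => _ //=; apply: leqW. Qed.

Lemma no_consec_destutter s : no_consec (destutter s).
Proof.
elim: s => //= a t IH; case: ifP => // /negbT h.
by case: (destutter t) h IH => //= b s' h ->; rewrite andbT eq_sym.
Qed.

Lemma size_strip b s : size (strip b s) <= size s.
Proof. by elim: s => //= a t IH; case: ifP => _ //=; apply: leqW. Qed.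

Lemma destutter_strip b s : destutter (strip b s) =
  if ohead (destutter s) == Some b then behead (destutter s) else destutter s.
Proof.
elim: s => // a t IH; rewrite ohead_destutter.
have -> : strip b (a :: t) = if a == b then strip b t else a :: t by [].
have -> : (Some a == Some b) = (a == b) by [].
case: eqP => [->|//]; rewrite IH /=; case: ifP => //.
Qed.

Lemma subseq_nseq_cat_neq a b k t v : a != b ->
  subseq (a :: t) (nseq k b ++ v) = subseq (a :: t) v.
Proof. by move=> /negbTE ne; elim: k => //= k IH; rewrite ne. Qed.

Lemma subseq_nseq_cat k b r v : size r <= k ->
  subseq r (nseq k b ++ v) = subseq (strip b r) v.
Proof.
elim: k r => [|k IH] [|a t] //= sz; rewrite ?sub0seq //.
case: (eqVneq a b) => [_|ne]; first exact: IH.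
by rewrite subseq_nseq_cat_neq.
Qed.

(** A letter of w repeated k times can match a whole run of equal letters in r, so only the sequence
    of runs of r matters. *)
Lemma subseq_stretch k r w : size r <= k ->
  subseq r (stretch k w) = subseq (destutter r) w.
Proof.
elim: w r => [|b w IH] r sz.
  rewrite [stretch k _]/= !subseq0; case: r {sz} => // a t.
  by have := ohead_destutter a t; case: (destutter _).
rewrite [stretch k _]/= -/(stretch k w) subseq_nseq_cat // IH; last first.
  exact: leq_trans (size_strip _ _) sz.
by rewrite destutter_strip; case: (destutter r) => //= *; rewrite sub0seq.
Qed.

Fixpoint words n : seq (seq T) :=
  if n is n'.+1 then [::] :: [seq a :: w | a <- enum T, w <- words n']
  else [:: [::]].

Lemma mem_words n s : size s <= n -> s \in words n.
Proof.
elim: n s => [|n IH] [|a s] //= sz.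
by rewrite inE /=; apply/allpairsP; exists (a, s); rewrite mem_enum IH.
Qed.

End Destutter.

Lemma liIdPT_full (Sigma : finType) : liIdPT_gen (fun w : seq Sigma => subseq [::] w).
Proof. exact: lipt_base. Qed.

Lemma liIdPT_determined (Sigma : finType) (W : seq (seq Sigma)) (L : language Sigma) :
  (forall s, s \in W -> no_consec s) ->
  (forall w w', (forall s, s \in W -> subseq s w = subseq s w') -> L w -> L w') ->
  liIdPT L.
Proof.
elim: W L => [|s W IH] L hW hL.
  have [Ln|nLn] := pselect (L [::]).
    exists (fun w => subseq [::] w); first exact: liIdPT_full.
    by move=> w; rewrite sub0seq; split => // _; apply: hL Ln.
  exists (fun w => ~ subseq [::] w); first exact/lipt_compl/liIdPT_full.
  by move=> w; rewrite sub0seq; split => // Lw; case: nLn; apply: hL Lw.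
(* [Lb b] collects the words that no word of W distinguishes from a member of L with answer b for s.
   It depends on W alone, and L is recovered from the two cases. *)
pose Lb (b : bool) w := exists w', [/\ subseq s w' = b,
  forall t, t \in W -> subseq t w' = subseq t w & L w'].
have hLb b : liIdPT (Lb b).
  apply: IH => [t tW|w w' hw]; first by apply: hW; rewrite inE tW orbT.
  by case=> w0 [h1 h2 h3]; exists w0; split=> // t tW; rewrite h2 ?hw.
have hs : no_consec s by apply: hW; rewrite mem_head.
have [L1 g1 e1] := hLb true; have [L0 g0 e0] := hLb false.
exists (fun w => (subseq s w /\ L1 w) \/ (~ subseq s w /\ L0 w)).
  apply: lipt_union; apply: lipt_inter => //; first exact: lipt_base.
  exact/lipt_compl/lipt_base.
have back b w : subseq s w = b -> Lb b w -> L w.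
  move=> hb [w' [h1 h2]]; apply: hL => t; rewrite inE => /orP [/eqP -> | /h2 //].
  by rewrite h1 hb.
move=> w; split=> [Lw|].
  case h : (subseq s w); [left|right]; split=> //.
    by apply/e1; exists w.
  by apply/e0; exists w.
by case=> -[h /=]; [move/e1|move/e0]; apply: back => //; apply/negP.
Qed.

(** * Syntactic congruence; from V(J) to liIdPT *)

Section SyntacticCongruence.
Variables (Sigma : finType) (L : language Sigma).
Implicit Types u v w : seq Sigma.

Lemma syn_eq_refl u : syn_eq L u u.
Proof. by []. Qed.

Lemma syn_eq_sym u v : syn_eq L u v -> syn_eq L v u.
Proof. by move=> h x y; rewrite h. Qed.

Lemma syn_eq_trans u v w : syn_eq L u v -> syn_eq L v w -> syn_eq L u w.
Proof. by move=> h1 h2 x y; rewrite h1. Qed.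

Lemma syn_eq_catr u v w : syn_eq L u v -> syn_eq L (u ++ w) (v ++ w).
Proof. by move=> h x y; rewrite -!catA; apply: h. Qed.

Lemma syn_eq_catl u v w : syn_eq L u v -> syn_eq L (w ++ u) (w ++ v).
Proof. by move=> h x y; rewrite -!catA !(catA x w); apply: h. Qed.

Lemma syn_eq_language u v : syn_eq L u v -> L u <-> L v.
Proof. by move=> /(_ [::] [::]); rewrite !cats0. Qed.

(** Mutual divisibility makes the two ideals equal; this is the form in which J-triviality is
    applied. *)
Lemma synJtrivial_eq u v : synJtrivial L ->
  (exists a b, syn_eq L u (a ++ v ++ b)) ->
  (exists a b, syn_eq L v (a ++ u ++ b)) -> syn_eq L u v.
Proof.
move=> J [a [b uv]] [c [d vu]]; apply: J => w; split=> -[p [q h]].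
  exists (p ++ a), (b ++ q); apply: syn_eq_trans h _.
  by have := syn_eq_catl p (syn_eq_catr q uv); rewrite -!catA.
exists (p ++ c), (d ++ q); apply: syn_eq_trans h _.
by have := syn_eq_catl p (syn_eq_catr q vu); rewrite -!catA.
Qed.

Lemma syn_eq_stretch k w : (forall s, syn_eq L [:: s; s] [:: s]) ->
  syn_eq L (stretch k.+1 w) w.
Proof.
move=> idem; have run a : syn_eq L (nseq k.+1 a) [:: a].
  elim: k => // k IH; apply: syn_eq_trans (idem a).
  exact: (@syn_eq_catl _ _ [:: a]).
elim: w => [//|a w IH].
apply: (@syn_eq_trans _ ([:: a] ++ stretch k.+1 w)).
  exact: (@syn_eq_catr (nseq k.+1 a) [:: a]).
exact: (@syn_eq_catl _ _ [:: a]).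
Qed.

Lemma VJbar_liIdPT : VJbar L -> liIdPT L.
Proof.
case=> -[Q [q0 [d [F hF]]]] J idem.
(* The action of a word on the automaton is a finite invariant refining the syntactic congruence. *)
pose tau (w : seq Sigma) : {ffun Q -> Q} := [ffun q => foldl d q w].
have tauE u v : tau u = tau v -> syn_eq L u v.
  move=> e x y; rewrite !hF !foldl_cat.
  by have := congr1 (fun f : {ffun Q -> Q} => f (foldl d q0 x)) e; rewrite !ffunE => ->.
have Rtriv u s t : syn_eq L u (u ++ s ++ t) -> syn_eq L u (u ++ s).
  move=> h; apply: synJtrivial_eq => //.
    by exists [::], t; rewrite /= -catA.
  by exists [::], s.
have Ltriv u s t : syn_eq L u (s ++ t ++ u) -> syn_eq L u (t ++ u).
  move=> h; apply: synJtrivial_eq => //.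
    by exists s, [::]; rewrite cats0.
  by exists t, [::]; rewrite cats0.
set n := (#|{ffun Q -> Q}| + #|{ffun Q -> Q}|).
apply: (@liIdPT_determined _ [seq s <- words Sigma n | no_consec s]).
  by move=> s; rewrite mem_filter => /andP [].
move=> w w' hw.
(* Idempotent letters allow w and w' to be stretched; n + 1 copies suffice to reduce subwords of
   length at most n to destuttered ones. *)
have /syn_eq_language <- := @syn_eq_stretch n w idem.
have /syn_eq_language <- := @syn_eq_stretch n w' idem.
suff /syn_eq_language <- : syn_eq L (stretch n.+1 w) (stretch n.+1 w') by [].
apply: (simon syn_eq_sym syn_eq_trans syn_eq_catr syn_eq_catl tauE Rtriv Ltriv).
move=> r sr; rewrite !subseq_stretch ?leqW //; apply: hw.
rewrite mem_filter no_consec_destutter mem_words //.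
exact: leq_trans (size_destutter _) sr.
Qed.

End SyntacticCongruence.

Import Order.TTheory GRing.Theory Num.Theory.
Local Open Scope ring_scope.

(** * Averaging automata *)

Section Averaging.
Variables (K : numFieldType) (S : finType) (T : eqType).
Implicit Types (f : S -> T) (mu nu : S -> K).

(** Conditional expectation for the uniform measure on S and the partition into fibres of f. *)
Definition avg f mu (s : S) : K :=
  (\sum_(t | f t == f s) mu t) / #|[pred t | f t == f s]|%:R.

Lemma block_gt0 f s : (0 < #|[pred t | f t == f s]|)%N.
Proof. by apply/card_gt0P; exists s; rewrite inE. Qed.

Lemma block_neq0 f s : #|[pred t | f t == f s]|%:R != 0 :> K.
Proof. by rewrite pnatr_eq0 -lt0n block_gt0. Qed.

Lemma eq_avg f mu s t : f s = f t -> avg f mu s = avg f mu t.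
Proof. by rewrite /avg => ->. Qed.

Lemma avg_le f mu nu s : (forall t, f t = f s -> mu t <= nu t) ->
  avg f mu s <= avg f nu s.
Proof.
move=> h; rewrite /avg ler_pM2r ?invr_gt0 ?ltr0n ?block_gt0 //.
by apply: ler_sum => t /eqP; apply: h.
Qed.

Lemma avg_const f c s : avg f (fun=> c) s = c.
Proof.
by rewrite /avg sumr_const -[c *+ _]mulr_natr mulfK // block_neq0.
Qed.

Lemma avgD f mu nu s : avg f (fun t => mu t + nu t) s = avg f mu s + avg f nu s.
Proof. by rewrite /avg big_split mulrDl. Qed.

Lemma avg_ge0 f mu s : (forall t, 0 <= mu t) -> 0 <= avg f mu s.
Proof. by move=> h; rewrite -{1}(avg_const f 0 s); apply: avg_le => t _. Qed.

Lemma sum_avg f mu : \sum_s avg f mu s = \sum_s mu s.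
Proof.
rewrite /avg; under eq_bigr do rewrite mulr_suml.
rewrite (exchange_big_dep predT) //=; apply: eq_bigr => t _.
transitivity (\sum_(s | f s == f t) mu t / #|[pred t0 | f t0 == f t]|%:R).
  by apply: eq_big => [s|s /eqP ->]; rewrite 1?eq_sym.
by rewrite sumr_const -[_ *+ _]mulr_natr divfK // block_neq0.
Qed.

Lemma avg_le_avg f mu s t :
  (forall s' t', f s' = f s -> f t' = f t -> mu t' <= mu s') ->
  avg f mu t <= avg f mu s.
Proof.
move=> h; rewrite -[leRHS](avg_const f _ t); apply: avg_le => t' et.
by rewrite -[leLHS](avg_const f _ s); apply: avg_le => s' es; apply: h.
Qed.

Variable Sigma : Type.

Definition avg_dist (cls : Sigma -> S -> T) (s0 : S) (x : seq Sigma) : S -> K :=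
  foldl (fun mu c => avg (cls c) mu) (fun s => (s == s0)%:R) x.

Lemma avg_dist_rcons cls s0 x c :
  avg_dist cls s0 (rcons x c) = avg (cls c) (avg_dist cls s0 x).
Proof. by rewrite /avg_dist foldl_rcons. Qed.

Lemma avg_dist_ge0 cls s0 x s : 0 <= avg_dist cls s0 x s.
Proof.
elim/last_ind: x s => [|x c IH] s; first by rewrite ler0n.
by rewrite avg_dist_rcons avg_ge0.
Qed.

Lemma sum_avg_dist cls s0 x : \sum_s avg_dist cls s0 x s = 1.
Proof.
elim/last_ind: x => [|x c IH]; last by rewrite avg_dist_rcons sum_avg.
by rewrite (bigD1 s0) //= /avg_dist /= eqxx big1 ?addr0 // => s /negbTE ->.
Qed.

End Averaging.

Lemma avg_prod (K : numFieldType) (S1 S2 : finType) (T1 T2 : eqType)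
    (f1 : S1 -> T1) (f2 : S2 -> T2) (mu1 : S1 -> K) (mu2 : S2 -> K) s :
  avg (fun p => (f1 p.1, f2 p.2)) (fun p => mu1 p.1 * mu2 p.2) s =
  avg f1 mu1 s.1 * avg f2 mu2 s.2.
Proof.
rewrite /avg mulrACA -invfM -natrM; congr (_ / _%:R).
  by rewrite big_distrlr /= pair_big; apply: eq_bigl => p; rewrite xpair_eqE.
rewrite -!sum1_card big_distrlr /= pair_big /=.
by apply: eq_big => // p; rewrite !inE xpair_eqE.
Qed.

Lemma avg_dist_prod (K : numFieldType) (Sigma : Type) (S1 S2 : finType)
    (T1 T2 : eqType) (cls1 : Sigma -> S1 -> T1) (cls2 : Sigma -> S2 -> T2) s1 s2 x :
  avg_dist K (fun c p => (cls1 c p.1, cls2 c p.2)) (s1, s2) x =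
  fun p => avg_dist K cls1 s1 x p.1 * avg_dist K cls2 s2 x p.2.
Proof.
elim/last_ind: x => [|x c IH]; apply: funext => p.
  by rewrite /avg_dist /= -natrM mulnb; case: p.
by rewrite !avg_dist_rcons IH avg_prod.
Qed.

(** * Boolean closure of the languages of averaging automata *)

Section AveragingLanguages.
Variables (K : numFieldType) (Sigma : finType).
Implicit Types L : language Sigma.

Definition avg_approx (e : K) L :=
  exists (S : finType) (T : eqType) (cls : Sigma -> S -> T) (s0 : S) (A : pred S),
  forall x, let p := \sum_(s | A s) avg_dist K cls s0 x s in
    (L x -> 1 - e <= p) /\ (~ L x -> p <= e).

(** Arbitrarily small errors are demanded because an intersection adds up the errors of its two
    automata, so that a fixed bound would not be preserved. *)
Definition avg_recognizable L := forall n : nat, avg_approx n.+1%:R^-1 L.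

Lemma avg_recognizable_compl L :
  avg_recognizable L -> avg_recognizable (fun w => ~ L w).
Proof.
move=> h n; have [S [T [cls [s0 [A hA]]]]] := h n.
exists S, T, cls, s0, (predC A) => x /=.
have := sum_avg_dist K cls s0 x; rewrite (bigID A) /= => /eqP.
rewrite addrC eq_sym -subr_eq => /eqP <-.
have [h1 h2] := hA x; split=> [/h2|/contrapT /h1] h3.
  by rewrite lerD2l lerN2.
by rewrite lerBlDr addrC -lerBlDr.
Qed.

Lemma avg_recognizable_inter L1 L2 :
  avg_recognizable L1 -> avg_recognizable L2 ->
  avg_recognizable (fun w => L1 w /\ L2 w).
Proof.
(* Here m + 1 = 2 (n + 1), so two errors 1/(m + 1) add up to 1/(n + 1). *)
move=> h1 h2 n; set m := (n.*2).+1.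
have [S1 [T1 [cls1 [s1 [A1 hA1]]]]] := h1 m.
have [S2 [T2 [cls2 [s2 [A2 hA2]]]]] := h2 m.
exists (S1 * S2)%type, (T1 * T2)%type, (fun c p => (cls1 c p.1, cls2 c p.2)), (s1, s2).
exists (fun p => A1 p.1 && A2 p.2) => x /=.
rewrite avg_dist_prod -(pair_big A1 A2 (fun i j =>
  avg_dist K cls1 s1 x i * avg_dist K cls2 s2 x j)) /= -big_distrlr /=.
have [] := hA1 x; have [] := hA2 x; rewrite /=.
have p_le1 (S : finType) (T : eqType) cls s0 (A : pred S) :
    0 <= \sum_(s | A s) @avg_dist K S T Sigma cls s0 x s <= 1.
  rewrite -(sum_avg_dist K cls s0 x) [X in _ <= _ <= X](bigID A) /=.
  by rewrite lerDl !sumr_ge0 // => *; apply: avg_dist_ge0.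
have := p_le1 _ _ cls1 s1 A1; have := p_le1 _ _ cls2 s2 A2.
set p1 := \sum_(s | A1 s) _; set p2 := \sum_(s | A2 s) _.
have -> : n.+1%:R^-1 = m.+1%:R^-1 + m.+1%:R^-1 :> K.
  have -> : m.+1 = (2 * n.+1)%N by rewrite /m; lia.
  have nz : (n.+1)%:R != 0 :> K by rewrite pnatr_eq0.
  by rewrite natrM; field; rewrite nat1r pnatr_eq0.
have e0 : 0 <= m.+1%:R^-1 :> K by rewrite invr_ge0.
have e1 : m.+1%:R^-1 <= 1 :> K by rewrite invf_le1 ?ler1n ?ltr0n.
move: m.+1%:R^-1 e0 e1 => e e0 e1 /andP[p2_0 p2_1] /andP[p1_0 p1_1] hp2 hn2 hp1 hn1.
split=> [[/hp1 h /hp2 h']|].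
  apply: le_trans (ler_pM _ _ h h'); rewrite ?subr_ge0 //.
  have -> : (1 - e) * (1 - e) = 1 - (e + e) + e * e by ring.
  by rewrite lerDl mulr_ge0.
case/not_andP=> [/hn1|/hn2] h.
  by apply: le_trans (ler_piMr p1_0 p2_1) _; rewrite (le_trans h) // lerDl.
by apply: le_trans (ler_piMl p2_0 p1_1) _; rewrite (le_trans h) // lerDl.
Qed.

Lemma avg_recognizable_ext L1 L2 : (forall w, L1 w <-> L2 w) ->
  avg_recognizable L1 -> avg_recognizable L2.
Proof.
move=> h r n; have [S [T [cls [s0 [A hA]]]]] := r n.
by exists S, T, cls, s0, A => x; rewrite -(propext (h x)); apply: hA.
Qed.

Lemma avg_recognizable_union L1 L2 :
  avg_recognizable L1 -> avg_recognizable L2 ->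
  avg_recognizable (fun w => L1 w \/ L2 w).
Proof.
move=> h1 h2.
apply: (@avg_recognizable_ext (fun w => ~ (~ L1 w /\ ~ L2 w))).
  by move=> w; rewrite -not_orE; split; [exact: contrapT | move=> h nh].
by apply/avg_recognizable_compl/avg_recognizable_inter; apply: avg_recognizable_compl.
Qed.

End AveragingLanguages.

(** * The averaging automaton of a scattered subword *)

Section ScatteredSubword.
Variables (Sigma : finType) (a : seq Sigma).
Implicit Types (b : Sigma) (i j : nat).

(** Step of the greedy matching automaton of a; its fibres are also the blocks of levels that b
    merges. *)
Definition next_level b i : nat := (i + (onth a i == Some b))%N.

Lemma next_level_le b i j : (i <= j)%N -> (next_level b i <= next_level b j)%N.
Proof.
rewrite leq_eqVlt => /orP [/eqP -> //|lt]; rewrite /next_level.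
by case: (_ == _); case: (_ == _); lia.
Qed.

Lemma onthE i : onth a i = ohead (drop i a).
Proof. by elim: a i => [|c s IH] [|i] //=. Qed.

Lemma next_level_size b i : (i <= size a)%N -> (next_level b i <= size a)%N.
Proof.
rewrite /next_level onthE; case: ltngtP => // [lt _|-> _].
  by case: (_ == _); lia.
by rewrite drop_size addn0.
Qed.

Lemma subseq_next_level x i : (i <= size a)%N ->
  subseq (drop i a) x = (foldl (fun j b => next_level b j) i x == size a).
Proof.
elim: x i => [|b x IH] i le /=.
  by rewrite -size_eq0 size_drop subn_eq0 eqn_leq le.
rewrite -IH ?next_level_size // /next_level onthE.
have [lt|ge] := ltnP i (size a); last first.
  by rewrite drop_oversize //= addn0 drop_oversize // sub0seq.
rewrite (drop_nth b lt) /=.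
have -> : (Some (nth b a i) == Some b) = (nth b a i == b) by [].
by case: eqP => _; rewrite ?addn1 // addn0 (drop_nth b lt).
Qed.

Lemma no_consec_onth i b : no_consec a -> onth a i = Some b -> onth a i.+1 != Some b.
Proof.
case: a => // c s /=; elim: s c i => [|d s IH] c [|i] //= /andP [ne p].
  by move=> [e]; apply/eqP => -[e']; rewrite e e' eqxx in ne.
exact: IH.
Qed.

Variables (K : numFieldType) (M : nat).
Hypothesis M_gt0 : (0 < M)%N.

(** Sizes grow by the factor M, so that uniform mass on two merged levels sits almost entirely in
    the upper one. *)
Definition levels := {i : 'I_(size a).+1 & 'I_(M ^ i)}.
Definition level (s : levels) : nat := tag s.
Definition level_cls b (s : levels) : nat := next_level b (level s).
Definition root_level : levels :=
  Tagged (fun i : 'I_(size a).+1 => 'I_(M ^ i)) (ord0 : 'I_(M ^ ord0)).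

Lemma sum_level_const (P : pred nat) (c : K) :
  \sum_(s : levels | P (level s)) c = \sum_(i < (size a).+1 | P i) c *+ (M ^ i).
Proof.
rewrite /levels /level.
transitivity (\sum_(i < (size a).+1 | P i) \sum_(j : 'I_(M ^ i)) c).
  by rewrite sig_big_dep /=; apply: eq_bigl => s; rewrite andbT.
by apply: eq_bigr => i _; rewrite sumr_const card_ord.
Qed.

(** Each level below j has at most M^(j-1) states, hence total weight at most 1/M at density
    M^-j. *)
Lemma sum_below j : (j <= size a)%N ->
  \sum_(s : levels | (level s < j)%N) M%:R ^- j <= (size a)%:R / M%:R :> K.
Proof.
move=> le; have M0 : 0 < M%:R :> K by rewrite ltr0n.
rewrite (sum_level_const (fun i => i < j)%N).
rewrite -(big_ord_widen _ (fun i => M%:R ^- j *+ (M ^ i))) 1?leqW //.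
apply: (@le_trans _ _ (\sum_(i < j) M%:R^-1)); last first.
  rewrite sumr_const card_ord -[leLHS]mulr_natl ler_pM2r ?invr_gt0 //.
  by rewrite ler_nat.
apply: ler_sum => i _; rewrite -[leLHS]mulr_natr natrX mulrC.
rewrite ler_pdivrMr ?exprn_gt0 // mulrC ler_pdivlMr // -exprSr.
by rewrite -!natrX ler_nat leq_pexp2l.
Qed.

Local Notation w := (avg_dist K level_cls root_level).

Lemma level0 (s : levels) : level s = 0%N -> s = root_level.
Proof.
case: s => i m; rewrite /level /= => i0.
have ei : i = ord0 by apply: val_inj.
move: m; rewrite ei => m; rewrite /root_level; congr (existT _ _ _).
by apply: val_inj; case: m => -[|m].
Qed.

(** Since [next_level] is monotone, the blocks follow the order of the levels, and averaging keeps
    the density nonincreasing. *)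
Lemma w_antitone x s t : (level s <= level t)%N -> w x t <= w x s.
Proof.
elim/last_ind: x s t => [|x c IH] s t le.
  rewrite /avg_dist /=; case: (eqVneq t root_level) => [et|_]; last exact: ler0n.
  by rewrite (@level0 s) ?eqxx //; move: le; rewrite et leqn0 => /eqP.
rewrite avg_dist_rcons.
have := next_level_le c le; rewrite leq_eqVlt => /orP [/eqP e|lt].
  by rewrite (@eq_avg _ _ _ (level_cls c) _ s t).
apply: avg_le_avg => s' t' es et; apply: IH.
rewrite leqNgt; apply/negP => /ltnW /(next_level_le c).
by rewrite -/(level_cls _ _) -/(level_cls _ _) es et leqNgt; move/negP; apply.
Qed.

(** Length of the longest prefix of a that is a subword of x, found greedily. *)
Let prog x := foldl (fun j b => next_level b j) 0%N x.

Lemma w_support x s : (prog x < level s)%N -> w x s = 0.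
Proof.
elim/last_ind: x s => [|x c IH] s.
  rewrite /avg_dist /=; case: eqP => // ->; by [].
rewrite avg_dist_rcons /prog foldl_rcons => lt.
rewrite /avg big1 ?mul0r // => t /eqP e; apply: IH.
rewrite ltnNge; apply/negP => /(next_level_le c); rewrite -/(level_cls c t) e.
by move=> h; have := leq_ltn_trans h lt; rewrite /level_cls /next_level; lia.
Qed.

Lemma prog_le x : (prog x <= size a)%N.
Proof.
elim/last_ind: x => // x c IH; rewrite /prog foldl_rcons.
exact: next_level_size.
Qed.

(* Up to an error [e] of small total mass, the distribution is bounded by the
   constant [M ^- j], a bound which averaging preserves; the levels below [j]
   are too small to carry much of it. *)
Lemma w_bound x : no_consec a -> exists e : levels -> K,
  [/\ forall s, 0 <= e s, forall s, w x s <= M%:R ^- prog x + e s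
    & \sum_s e s <= (prog x * size a)%:R / M%:R].
Proof.
move=> nc; have M0 : 0 < M%:R :> K by rewrite ltr0n.
elim/last_ind: x => [|x b [e [e0 he se]]].
  exists (fun=> 0); split=> [//|s|]; last by rewrite big1 // mul0r.
  by rewrite /prog /= expr0 invr1 addr0 /avg_dist /= lern1 leq_b1.
rewrite avg_dist_rcons /prog foldl_rcons -/(prog x).
set j := prog x in he se *.
have ae s : avg (level_cls b) (w x) s <= M%:R ^- j + avg (level_cls b) e s.
  by rewrite -[X in X + _](avg_const (level_cls b) _ s) -avgD; apply: avg_le.
rewrite /next_level; case: eqP => [ob|_]; last first.
  exists (avg (level_cls b) e); rewrite addn0 sum_avg; split=> // s.
  exact: avg_ge0.
have lej := next_level_size b (prog_le x).
rewrite -/j /next_level ob eqxx addn1 in lej.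
(* The letter b matches, so the bound has to sharpen by a factor M; the whole content of the levels
   below j becomes error. *)
exists (fun s => if (level s < j)%N then avg (level_cls b) (w x) s else 0).
have wge s : 0 <= avg (level_cls b) (w x) s.
  by apply: avg_ge0 => t; apply: avg_dist_ge0.
rewrite addn1; split=> [s|s|].
- by case: ifP.
- case: ltnP => [_|ge]; first by rewrite lerDr invr_ge0 exprn_ge0 ?ler0n.
  (* Each of the M^(j+1) states of level j + 1 carries at least as much as s: level j shares its
     block, and higher levels carry no more by [w_antitone]. The total mass is 1. *)
  rewrite addr0 -[leRHS]mul1r ler_pdivlMr ?exprn_gt0 // -natrX mulr_natr.
  have -> : avg (level_cls b) (w x) s *+ M ^ j.+1 =
    \sum_(t : levels | level t == j.+1) avg (level_cls b) (w x) s.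
    by rewrite (sum_level_const (pred1 j.+1)) (big_pred1 (Ordinal (lej : (j.+1 < (size a).+1)%N))).
  rewrite -(sum_avg_dist K level_cls root_level (rcons x b)) avg_dist_rcons.
  rewrite [leRHS](bigID (fun t => level t == j.+1)) /=.
  apply: ler_wpDr; first exact: sumr_ge0.
  apply: ler_sum => t /eqP et; rewrite leq_eqVlt in ge; case/orP: ge => [/eqP ge|lt].
    rewrite (@eq_avg _ _ _ (level_cls b) _ s t) // /level_cls et -ge /next_level.
    by rewrite ob eqxx (negbTE (no_consec_onth nc ob)) addn1 addn0.
  by rewrite -!avg_dist_rcons w_antitone // et.
rewrite -big_mkcond /=.
apply: (@le_trans _ _ (\sum_(s | (level s < j)%N) (M%:R ^- j + avg (level_cls b) e s))).
  exact: ler_sum.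
rewrite big_split /= mulSn natrD mulrDl; apply: lerD; last first.
  apply: le_trans se; rewrite -(sum_avg (level_cls b)) [leRHS](bigID (fun s => level s < j)%N) /=.
  by apply: ler_wpDr => //; apply: sumr_ge0 => s _; apply: avg_ge0.
exact/sum_below/prog_le.
Qed.

Lemma sum_w_last x : prog x = size a -> no_consec a ->
  1 - (size a * (size a).+1)%:R / M%:R <= \sum_(s : levels | level s == size a) w x s.
Proof.
move=> px nc; have M0 : 0 < M%:R :> K by rewrite ltr0n.
have := sum_avg_dist K level_cls root_level x.
rewrite (bigID (fun s => level s == size a)) /= => /eqP.
rewrite eq_sym -subr_eq => /eqP <-; rewrite lerD2l lerN2.
have [e [e0 he se]] := w_bound x nc; rewrite px in he se.
apply: (@le_trans _ _ (\sum_(s : levels | (level s < size a)%N) (M%:R ^- size a + e s))).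
  rewrite (eq_bigl (fun s : levels => level s < size a)%N); first exact: ler_sum.
  by move=> s; rewrite ltn_neqAle -ltnS ltn_ord andbT.
rewrite big_split /= mulnS natrD mulrDl; apply: lerD; last first.
  apply: le_trans se; rewrite [leRHS](bigID (fun s => level s < size a)%N) /=.
  by apply: ler_wpDr => //; apply: sumr_ge0.
exact: sum_below.
Qed.

End ScatteredSubword.

Lemma avg_recognizable_subseq (K : numFieldType) (Sigma : finType) (a : seq Sigma) :
  no_consec a -> avg_recognizable K (fun w => subseq a w).
Proof.
(* This M pushes the error |a| (|a| + 1) / M of [sum_w_last] below 1/(n + 1). *)
move=> nc n; set M := ((size a * (size a).+1) * n.+1).+1.
have M0 : (0 < M)%N by [].
exists (levels a M), nat, (@level_cls _ a M), (root_level a M).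
exists (fun s => level s == size a) => x /=.
have e := @subseq_next_level _ a x 0 (leq0n _); rewrite drop0 in e.
split=> [|/negP]; rewrite e => h.
  apply: le_trans (sum_w_last K M0 (eqP h) nc); rewrite lerD2l lerN2.
  rewrite ler_pdivrMr ?ltr0n // mulrC ler_pdivlMr ?ltr0n // -natrM ler_nat.
  exact: leqnSn.
rewrite big1 ?invr_ge0 // => s /eqP es; apply: w_support => //.
by rewrite es ltn_neqAle h prog_le.
Qed.

Lemma avg_recognizable_liIdPT (K : numFieldType) (Sigma : finType) (L : language Sigma) :
  liIdPT_gen L -> avg_recognizable K L.
Proof.
elim=> [s|L' _|L1 L2 _ h1 _ h2|L1 L2 _ h1 _ h2].
- exact: avg_recognizable_subseq.
- exact: avg_recognizable_compl.
- exact: avg_recognizable_union.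
- exact: avg_recognizable_inter.
Qed.

(** * Quantum simulation of averaging automata *)

Lemma adjmxE m n (A : 'M[C]_(m, n)) i j : adjmx A i j = (A j i)^*.
Proof. by rewrite !mxE. Qed.

Lemma adjmxK m n (A : 'M[C]_(m, n)) : adjmx (adjmx A) = A.
Proof. by apply/matrixP => i j; rewrite !adjmxE conjCK. Qed.

Lemma adjmxM m n p (A : 'M[C]_(m, n)) (B : 'M[C]_(n, p)) :
  adjmx (A *m B) = adjmx B *m adjmx A.
Proof. by rewrite /adjmx map_mxM trmx_mul. Qed.

Lemma adjmxD m n (A B : 'M[C]_(m, n)) : adjmx (A + B) = adjmx A + adjmx B.
Proof. by rewrite /adjmx map_mxD linearD. Qed.

Lemma adjmxB m n (A B : 'M[C]_(m, n)) : adjmx (A - B) = adjmx A - adjmx B.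
Proof. by rewrite /adjmx map_mxB linearB. Qed.

Lemma adjmx0 m n : adjmx (0 : 'M[C]_(m, n)) = 0.
Proof. by rewrite /adjmx map_mx0 trmx0. Qed.

Lemma adjmxZ m n (c : C) (A : 'M[C]_(m, n)) : adjmx (c *: A) = c^* *: adjmx A.
Proof. by rewrite /adjmx map_mxZ linearZ. Qed.

Lemma adjmx_sum m n (I : Type) (r : seq I) (F : I -> 'M[C]_(m, n)) :
  adjmx (\sum_(i <- r) F i) = \sum_(i <- r) adjmx (F i).
Proof. exact: (big_morph _ (@adjmxD m n) (adjmx0 m n)). Qed.

Lemma adjmx1 n : adjmx (1%:M : 'M[C]_n) = 1%:M.
Proof. by rewrite /adjmx map_mx1 trmx1. Qed.

Lemma closed_prim_root (F : numClosedFieldType) n : (0 < n)%N ->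
  exists z : F, n.-primitive_root z.
Proof.
move=> n0; have [rs e] := closed_field_poly_normal ('X^n - 1 : {poly F}).
have m1 : lead_coef ('X^n - 1 : {poly F}) = 1 by exact/eqP/monicXnsubC.
rewrite m1 scale1r in e.
have sz : size rs = n.
  by apply: succn_inj; rewrite -(size_prod_XsubC rs id) -e size_XnsubC.
have rt : all n.-unity_root rs.
  by apply/allP => z zrs; rewrite /root_of_unity e root_prod_XsubC.
have us : uniq rs.
  rewrite -separable_prod_XsubC -e; apply: separable_Xn_sub_1.
  by rewrite pnatr_eq0 -lt0n.
have /hasP [z _ hz] := has_prim_root n0 rt us (eq_leq (esym sz)).
by exists z.
Qed.

Lemma norm_prim_root (F : numClosedFieldType) n (z : F) :
  n.-primitive_root z -> `|z| = 1.
Proof.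
move=> pz; have n0 := prim_order_gt0 pz.
by apply/eqP; rewrite -(pexpr_eq1 n0) // -normrX (prim_expr_order pz) normr1.
Qed.

(** * Fourier bases on the blocks of a partition *)

Section UnbiasedBasis.
Variables (n : nat) (T : eqType) (f : 'I_n -> T).

Let blk i := [pred t | f t == f i].
Let rk i := index i (enum (blk i)).

Let rk_lt i : (rk i < #|blk i|)%N.
Proof. by rewrite cardE index_mem mem_enum inE. Qed.

Let eq_blk i j : f i = f j -> blk i = blk j.
Proof. by rewrite /blk => ->. Qed.

Let sum_rk t (G : nat -> C) :
  \sum_(s | f s == f t) G (rk s) = \sum_(k < #|blk t|) G k.
Proof.
transitivity (\sum_(s <- enum (blk t)) G (index s (enum (blk t)))).
  rewrite big_enum /=; apply: eq_bigr => s /eqP e.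
  by rewrite /rk (eq_blk e).
rewrite (big_nth t) -cardE big_mkord; apply: eq_bigr => k _.
by rewrite index_uniq ?enum_uniq // -cardE.
Qed.

(** U is block diagonal, with the normalized discrete Fourier matrix on each block, indexed by the
    ranks [rk]. *)
Lemma unbiased_basis : exists U : 'M[C]_n,
  [/\ forall i j, f i != f j -> U i j = 0,
      forall i j, f i = f j -> (U i j)^* * U i j = #|[pred t | f t == f i]|%:R^-1
    & adjmx U *m U = 1%:M].
Proof.
have /choice [om hom] N : exists z : C, (0 < N)%N -> N.-primitive_root z.
  case: N => [|N]; first by exists 0.
  by have [z hz] := closed_prim_root C (ltn0Sn N); exists z.
have bpos i : (0 < #|blk i|)%N by apply: leq_ltn_trans (rk_lt i).
have hp i := hom _ (bpos i).
have conj_om i k : (om #|blk i| ^+ k)^* * om #|blk i| ^+ k = 1.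
  by rewrite mulrC -normCK normrX (norm_prim_root (hp i)) !expr1n.
have conj_sq (N : nat) : ((sqrtC N%:R)^-1)^* * (sqrtC N%:R)^-1 = N%:R^-1 :> C.
  rewrite mulrC -normCK normfV exprVn; congr (_^-1).
  by rewrite ger0_norm ?sqrtCK ?sqrtC_ge0 ?ler0n.
exists (\matrix_(i, j) if f i == f j then
  (sqrtC #|blk i|%:R)^-1 * om #|blk i| ^+ (rk i * rk j) else 0).
split=> [i j /negbTE h|i j e|]; rewrite ?mxE ?h //.
  by rewrite (introT eqP e) rmorphM mulrACA conj_om mulr1 conj_sq.
apply/matrixP => t t'; rewrite !mxE.
have [e|ne] := eqVneq (f t) (f t'); last first.
  have -> : (t == t') = false by apply: contraNF ne => /eqP ->.
  apply: big1 => s _; rewrite !mxE.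
  case: eqP => [e|_]; last by rewrite conjC0 mul0r.
  by rewrite e (negbTE ne) mulr0.
(* Within a block, the inner product of columns t and t' is a geometric sum over a root of unity z
   that equals 1 only if t = t'. *)
set z := (om #|blk t| ^+ rk t)^* * om #|blk t| ^+ rk t'.
transitivity (#|blk t|%:R^-1 * \sum_(s | f s == f t) z ^+ rk s).
  rewrite mulr_sumr [RHS]big_mkcond; apply: eq_bigr => s _; rewrite !mxE -e.
  case: eqP => [es|_]; last by rewrite conjC0 mul0r.
  rewrite (eq_blk es) rmorphM mulrACA conj_sq; congr (_ * _).
  by rewrite ![(rk s * _)%N]mulnC !exprM rmorphXn -exprMn.
rewrite (sum_rk t (fun k => z ^+ k)).
have [ett|net] := eqVneq t t'.
  have -> : z = 1 by rewrite /z -ett conj_om.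
  under eq_bigr do rewrite expr1n.
  by rewrite sumr_const card_ord mulVf // pnatr_eq0 -lt0n.
have z1 : z != 1.
  apply: contra net => /eqP z1.
  have : om #|blk t| ^+ rk t == om #|blk t| ^+ rk t'.
    by rewrite -[X in X == _]mulr1 -z1 /z mulrA [_ * _^*]mulrC conj_om mul1r.
  rewrite (eq_prim_root_expr (hp t)) !modn_small ?rk_lt //; last first.
    by rewrite (eq_blk e) rk_lt.
  rewrite /rk -(eq_blk e) => /eqP er.
  have mt : t \in enum (blk t) by rewrite mem_enum inE.
  have mt' : t' \in enum (blk t) by rewrite mem_enum inE e.
  by rewrite -(nth_index t mt) er (nth_index t mt').
have zb : z ^+ #|blk t| = 1.
  rewrite /z exprMn -rmorphXn -!exprM ![(rk _ * _)%N]mulnC !exprM.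
  by rewrite (prim_expr_order (hp t)) !expr1n rmorph1 mulr1.
have : (z - 1) * \sum_(k < #|blk t|) z ^+ k = 0 by rewrite -subrX1 zb subrr.
by move/eqP; rewrite mulf_eq0 subr_eq0 (negbTE z1) /= => /eqP ->; rewrite mulr0.
Qed.

End UnbiasedBasis.

(** * Measurement in an orthonormal basis *)

Section UnitaryObservable.
Variables (n : nat) (U : 'M[C]_n).
Hypothesis UU : adjmx U *m U = 1%:M.

Definition basis_proj i : 'M[C]_n := adjmx (row i U) *m row i U.

(** The eigenvalue i is a label for outcome i; naturals stay distinct in characteristic zero. *)
Definition basis_spec : seq (C * 'M[C]_n) :=
  [seq ((i : nat)%:R, basis_proj i) | i : 'I_n <- enum 'I_n].

Lemma row_adj i j : row i U *m adjmx (row j U) = (i == j)%:R%:M.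
Proof.
have UU' : U *m adjmx U = 1%:M by apply: mulmx1C.
apply/matrixP => p q; rewrite !ord1 mxE.
have := congr1 (fun A : 'M[C]_n => A i j) UU'; rewrite !mxE mulr1n => <-.
by apply: eq_bigr => k _; rewrite !mxE.
Qed.

Lemma basis_projM i j : basis_proj i *m basis_proj j =
  if i == j then basis_proj i else 0.
Proof.
rewrite /basis_proj mulmxA -(mulmxA (adjmx _)) row_adj.
case: eqP => [->|_]; first by rewrite mulmx1.
by rewrite raddf0 mulmx0 mul0mx.
Qed.

Lemma basis_proj_adj i : adjmx (basis_proj i) = basis_proj i.
Proof. by rewrite /basis_proj adjmxM adjmxK. Qed.

Lemma basis_proj_neq0 i : basis_proj i != 0.
Proof.
apply/eqP => h; have : row i U *m basis_proj i *m adjmx (row i U) = 0.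
  by rewrite h mulmx0 mul0mx.
rewrite /basis_proj mulmxA row_adj eqxx mul1mx row_adj eqxx => /matrixP /(_ 0 0).
by rewrite !mxE => /eqP; rewrite oner_eq0.
Qed.

Lemma sum_basis_proj : \sum_i basis_proj i = 1%:M.
Proof.
rewrite -UU; apply/matrixP => p q; rewrite summxE mxE.
by apply: eq_bigr => i _; rewrite !mxE big_ord1 !mxE.
Qed.

Fact basis_herm : adjmx (\sum_(rp <- basis_spec) rp.1 *: rp.2) =
  \sum_(rp <- basis_spec) rp.1 *: rp.2.
Proof.
rewrite adjmx_sum big_map [RHS]big_map; apply: eq_bigr => i _.
by rewrite adjmxZ basis_proj_adj conjC_nat.
Qed.

Fact basis_uniq : uniq (map fst basis_spec).
Proof.
rewrite -map_comp map_inj_uniq ?enum_uniq // => i j /= h.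
by apply/val_inj/eqP; rewrite -(eqr_nat C); apply/eqP.
Qed.

Fact basis_spec_proj rp : rp \in basis_spec ->
  [/\ rp.2 *m rp.2 = rp.2, adjmx rp.2 = rp.2 & rp.2 != 0].
Proof.
move=> /mapP [i _ ->]; split=> /=.
- by rewrite basis_projM eqxx.
- exact: basis_proj_adj.
- exact: basis_proj_neq0.
Qed.

Fact basis_orth rp rq : rp \in basis_spec -> rq \in basis_spec ->
  rp.1 != rq.1 -> rp.2 *m rq.2 = 0.
Proof.
move=> /mapP [i _ ->] /mapP [j _ ->] /= ne; rewrite basis_projM.
by case: (eqVneq i j) ne => // ->; rewrite eqxx.
Qed.

Fact basis_sum : \sum_(rp <- basis_spec) rp.2 = 1%:M.
Proof. by rewrite big_map big_enum -sum_basis_proj. Qed.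

Definition basis_observable : observable n :=
  Observable basis_herm basis_uniq basis_spec_proj basis_orth basis_sum erefl.

Lemma measure_basis rho : measure basis_observable rho =
  \sum_i basis_proj i *m rho *m basis_proj i.
Proof. by rewrite /measure [obs_spec _]/= /basis_spec big_map big_enum. Qed.

(** Row i of U is unbiased on its block, so outcome i has the block average of mu as weight. This
    weight is constant on the block, where the basis projectors sum to the identity, so the result
    is diagonal again. *)
Lemma measure_basis_diag (T : eqType) (f : 'I_n -> T) (mu : 'I_n -> C) :
  (forall i j, f i != f j -> U i j = 0) ->
  (forall i j, f i = f j -> (U i j)^* * U i j = #|[pred t | f t == f i]|%:R^-1) ->
  measure basis_observable (diag_mx (\row_i mu i)) = diag_mx (\row_i avg f mu i).
Proof.
move=> U0 U1; rewrite measure_basis.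
have step i : basis_proj i *m diag_mx (\row_i mu i) *m basis_proj i =
    avg f mu i *: basis_proj i.
  have E : row i U *m (diag_mx (\row_i mu i) *m adjmx (row i U)) = (avg f mu i)%:M.
    apply/matrixP => p q; rewrite !ord1 mul_diag_mx !mxE mulr1n /avg mulr_suml.
    rewrite [RHS]big_mkcond; apply: eq_bigr => k _; rewrite !mxE.
    rewrite [f k == _]eq_sym; case: eqP => [e|/eqP ne]; last by rewrite U0 ?mul0r.
    by rewrite mulrCA [U i k * _]mulrC U1.
  transitivity (adjmx (row i U) *m (row i U *m (diag_mx (\row_i mu i) *m
    adjmx (row i U))) *m row i U); first by rewrite /basis_proj !mulmxA.
  by rewrite E mul_mx_scalar -scalemxAl.
under eq_bigr do rewrite step.
apply/matrixP => p q.
transitivity (\sum_i (avg f mu i *: basis_proj i) p q); first exact: summxE.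
rewrite !mxE; transitivity (avg f mu p * \sum_i (basis_proj i) p q).
  rewrite mulr_sumr; apply: eq_bigr => i _; rewrite !mxE big_ord1 !mxE.
  have [e|ne] := eqVneq (f i) (f p); first by rewrite (eq_avg mu e).
  by rewrite (U0 _ _ ne) conjC0 !mul0r !mulr0.
rewrite -summxE sum_basis_proj mxE.
by case: eqP => [->|_]; rewrite ?mulr1 ?mulr0.
Qed.

End UnitaryObservable.

Lemma avg_reindex (K : numFieldType) (S S' : finType) (T : eqType)
    (h : S' -> S) (f : S -> T) (mu : S -> K) i :
  bijective h -> avg (f \o h) (mu \o h) i = avg f mu (h i).
Proof.
move=> bh; rewrite /avg -!sum1_card; congr (_ / _%:R).
  by rewrite [RHS](reindex h) //; apply: onW_bij.
by rewrite [RHS](reindex h) //; apply: onW_bij.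
Qed.

Lemma trace_basis1 n (A : 'M[C]_n) i : \tr (basis_proj 1%:M i *m A) = A i i.
Proof.
rewrite /basis_proj -mulmxA mxtrace_mulC -row_mul mul1mx /mxtrace big_ord1 mxE.
rewrite (@big_only1 _ _ _ _ i) // => [|k ne _]; rewrite !mxE.
  by rewrite eqxx rmorph1 mulr1.
by rewrite eq_sym (negbTE ne) rmorph0 mulr0.
Qed.

Lemma avg_recognizable_LMO (Sigma : finType) (L : language Sigma) :
  avg_recognizable C L -> LMO L.
Proof.
(* Error 1/4 is enough: with cut-point 1/2 it leaves a gap of 1/4. *)
move=> /(_ 3) [S [T [cls [s0 [A hA]]]]].
set n := #|S|; pose ev (i : 'I_n) : S := enum_val i.
have ev_bij : bijective ev.
  by exists enum_rank => i; rewrite /ev ?enum_valK ?enum_rankK.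
have /choice [U hU] c := unbiased_basis (cls c \o ev).
have UU c : adjmx (U c) *m U c = 1%:M by have [] := hU c.
have UU1 : adjmx (1%:M : 'M[C]_n) *m 1%:M = 1%:M by rewrite adjmx1 mulmx1.
pose obs (oc : option Sigma) :=
  if oc is Some c then basis_observable (UU c) else basis_observable UU1.
pose init : 'rV[C]_n := \row_i (ev i == s0)%:R.
have init_norm : \sum_(i < n) `|init 0 i| ^+ 2 = 1.
  rewrite (@big_only1 _ _ _ _ (enum_rank s0)) // => [|i ne _]; rewrite mxE /ev.
    by rewrite enum_rankK eqxx normr1 expr1n.
  by rewrite -[s0]enum_rankK (inj_eq enum_val_inj) (negbTE ne) normr0 expr0n.
pose acc : seq C := [seq (i : nat)%:R | i : 'I_n <- enum 'I_n & A (ev i)].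
have acc_sub : {subset acc <= spectrum (obs None)}.
  move=> r /mapP [i _ ->]; apply/mapP; exists ((i : nat)%:R, basis_proj 1%:M i) => //.
  by apply/mapP; exists i; rewrite ?mem_enum.
pose Q := Mon1qfa init_norm acc_sub.
have rhoE x : rho_word Q x = diag_mx (\row_i avg_dist C cls s0 x (ev i)).
  elim/last_ind: x => [|x c IH].
    apply/matrixP => i j; rewrite /rho_word /= /rho0 /= !mxE big_ord1 !mxE.
    rewrite conjC_nat -natrM mulnb /avg_dist /=.
    have [->|ne] := eqVneq i j; first by rewrite andbb.
    rewrite mulr0n; case: eqP => // e1; case: eqP => // e2.
    by case/eqP: ne; apply: enum_val_inj; rewrite -/(ev i) -/(ev j) e1 e2.
  rewrite /rho_word foldl_rcons -/(rho_word Q x) IH [qobs _ _]/=.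
  have [h1 h2 _] := hU c.
  rewrite (measure_basis_diag (UU c) _ h1 h2) avg_dist_rcons.
  by congr diag_mx; apply/rowP => i; rewrite !mxE; apply: avg_reindex.
have accE x : accprob Q x = \sum_(s | A s) avg_dist C cls s0 x s.
  rewrite /accprob rhoE [obs_spec _]/= /basis_spec big_map big_enum_cond.
  rewrite [RHS](reindex ev); last exact: onW_bij.
  apply: eq_big => [i|i _].
    change (((i : nat)%:R \in acc) = A (ev i)).
    apply/mapP/idP => [[j]|Ai]; last by exists i => //; rewrite mem_filter Ai mem_enum.
    rewrite mem_filter => /andP [Aj _] /eqP; rewrite eqr_nat => /eqP e.
    by rewrite (val_inj e).
  by rewrite trace_basis1 !mxE eqxx.
pose h : C := 2%:R^-1; pose e : C := 4%:R^-1.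
have e0 : 0 < e by rewrite invr_gt0 ltr0n.
have hE : h = e + e by rewrite /h /e; field.
have e1 : 1 - e = h + e by rewrite /h /e; field.
have in_L x : L x -> h + e <= accprob Q x.
  by move=> Lx; have [/(_ Lx) + _] := hA x; rewrite -e1 accE.
have out_L x : ~ L x -> accprob Q x <= h - e.
  by move=> Lx; have [_ /(_ Lx)] := hA x; rewrite hE addrK accE.
exists Q, h; split; first by rewrite hE realD // gtr0_real.
split=> [x|].
  split=> [/in_L|hx]; first by apply: lt_le_trans; rewrite ltrDl.
  apply: contrapT => /out_L le; have := lt_le_trans hx le.
  by rewrite ltrDl oppr_gt0 => lt; have := lt_trans e0 lt; rewrite ltxx.
exists e => // x; have [/in_L le|/out_L le] := pselect (L x).
  have le' : e <= accprob Q x - h by rewrite lerBrDl.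
  by rewrite ger0_norm // (le_trans (ltW e0)).
have le' : e <= h - accprob Q x by rewrite lerBrDr addrC -lerBrDr.
by rewrite distrC ger0_norm // (le_trans (ltW e0)).
Qed.

(** * Products of orthogonal projections *)

Lemma C_archimedean (x : C) : 0 <= x -> exists n : nat, x < n%:R.
Proof.
move=> x0; have xr : x \is Num.real by exact: ger0_real.
have e : (complex.Re x)%:C%C = x by exact: RRe_real.
have r0 : 0 <= complex.Re x by move: x0; rewrite -e lecR.
exists (Num.bound (complex.Re x)); rewrite -e.
have -> : (Num.bound (complex.Re x))%:R = ((Num.bound (complex.Re x))%:R)%:C%C :> C.
  by rewrite rmorph_nat.
by rewrite ltcR archi_boundP.
Qed.

(** Otherwise f would lose more than e at each step and become negative. *)
Lemma small_descent (f : nat -> C) (e : C) : (forall n, 0 <= f n) -> 0 < e ->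
  exists n, f n - f n.+1 <= e.
Proof.
move=> f0 e0; apply: contrapT => /forallNP h.
have fr n : f n \is Num.real by exact: ger0_real.
have step n : f n.+1 <= f n - e.
  have /negP := h n; rewrite -real_ltNge ?realB ?(gtr0_real e0) // => /ltW.
  by rewrite lerBrDr addrC -lerBrDr.
have lin n : f n <= f 0%N - n%:R * e.
  elim: n => [|n IH]; first by rewrite mul0r subr0.
  apply: le_trans (step n) _; rewrite -natr1 mulrDl mul1r opprD addrA.
  by rewrite lerD2r.
have [n hn] : exists n : nat, f 0%N / e < n%:R by apply/C_archimedean/divr_ge0/ltW.
have := le_trans (f0 n) (lin n); rewrite subr_ge0 -ler_pdivlMr // => le.
by have := lt_le_trans hn le; rewrite ltxx.
Qed.

Section MatrixNorms.
Variables m n : nat.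
Implicit Types A B : 'M[C]_(m, n).

(** Square of the Frobenius norm, for which projections obey Pythagoras; estimates of products use
    the submultiplicative [l1]. *)
Definition frob A : C := \tr (A *m adjmx A).
Definition l1 A : C := \sum_i \sum_j `|A i j|.

Lemma frobE A : frob A = \sum_i \sum_j `|A i j| ^+ 2.
Proof.
apply: eq_bigr => i _; rewrite mxE; apply: eq_bigr => j _.
by rewrite adjmxE normCK.
Qed.

Lemma frob_ge0 A : 0 <= frob A.
Proof. by rewrite frobE; do 2!apply: sumr_ge0 => ? _; rewrite exprn_ge0. Qed.

Lemma l1_ge0 A : 0 <= l1 A.
Proof. by do 2!apply: sumr_ge0 => ? _. Qed.

Lemma le_sum_term (I : finType) (G : I -> C) i :
  (forall j, 0 <= G j) -> G i <= \sum_j G j.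
Proof.
move=> G0; have -> : G i = \sum_j (if j == i then G j else 0).
  by rewrite -big_mkcond big_pred1_eq.
by apply: ler_sum => j _; case: ifP.
Qed.

Lemma entry_frob A i j : `|A i j| ^+ 2 <= frob A.
Proof.
rewrite frobE.
apply: le_trans (@le_sum_term _ (fun j => `|A i j| ^+ 2) j _) _ => [k|].
  by rewrite exprn_ge0.
apply: (@le_sum_term _ (fun i => \sum_j `|A i j| ^+ 2)) => k.
by apply: sumr_ge0 => *; rewrite exprn_ge0.
Qed.

Lemma entry_l1 A i j : `|A i j| <= l1 A.
Proof.
apply: le_trans (@le_sum_term _ (fun j => `|A i j|) j _) _ => //.
by apply: (@le_sum_term _ (fun i => \sum_j `|A i j|)) => k; apply: sumr_ge0.
Qed.

Lemma l1_entry A c : (forall i j, `|A i j| <= c) -> l1 A <= (m * n)%:R * c.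
Proof.
move=> h; apply: (@le_trans _ _ (\sum_(i < m) \sum_(j < n) c)).
  by do 2!apply: ler_sum => ? _.
by under eq_bigr do rewrite sumr_const card_ord;
  rewrite sumr_const card_ord -mulrnA mulr_natl mulnC.
Qed.

Lemma l1_frob A c : 0 <= c -> frob A <= c ^+ 2 -> l1 A <= (m * n)%:R * c.
Proof.
move=> c0 h; apply: l1_entry => i j.
by rewrite -(@ler_pXn2r _ 2) ?nnegrE // (le_trans (entry_frob A i j)).
Qed.

Lemma l1D A B : l1 (A + B) <= l1 A + l1 B.
Proof.
rewrite /l1 -big_split; apply: ler_sum => i _; rewrite -big_split.
by apply: ler_sum => j _; rewrite mxE ler_normD.
Qed.

Lemma l1N A : l1 (- A) = l1 A.
Proof. by do 2!apply: eq_bigr => ? _; rewrite mxE normrN. Qed.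

Lemma l1_dist A B : l1 (A - B) = l1 (B - A).
Proof. by rewrite -l1N opprB. Qed.

End MatrixNorms.

Lemma l1_0 m n : l1 (0 : 'M[C]_(m, n)) = 0.
Proof. by do 2!apply: big1 => ? _; rewrite mxE normr0. Qed.

Lemma l1M m n p (A : 'M[C]_(m, n)) (B : 'M[C]_(n, p)) : l1 (A *m B) <= l1 A * l1 B.
Proof.
rewrite /l1 mulr_suml; apply: ler_sum => i _; rewrite mulr_suml.
apply: (@le_trans _ _ (\sum_j \sum_k `|A i k| * `|B k j|)).
  apply: ler_sum => j _; rewrite mxE; apply: le_trans (ler_norm_sum _ _ _) _.
  by apply: ler_sum => k _; rewrite normrM.
rewrite exchange_big; apply: ler_sum => k _; rewrite -mulr_sumr.
apply: ler_wpM2l => //.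
by apply: (@le_sum_term _ (fun k => \sum_j `|B k j|)) => *; apply: sumr_ge0.
Qed.

Lemma l1_adj m n (A : 'M[C]_(m, n)) : l1 (adjmx A) = l1 A.
Proof.
rewrite /l1 exchange_big; do 2!apply: eq_bigr => ? _.
by rewrite adjmxE norm_conjC.
Qed.

Lemma frob_proj m n (A : 'M[C]_(m, n)) P : P *m P = P -> adjmx P = P ->
  frob A = frob (A *m P) + frob (A - A *m P).
Proof.
move=> PP aP; rewrite /frob adjmxB adjmxM aP -raddfD; congr (\tr _).
rewrite mulmxBr !mulmxBl !mulmxA -(mulmxA A P P) PP.
by rewrite subrr subr0 addrC subrK.
Qed.

Definition wpow (T : Type) n (w : seq T) : seq T := iter n (cat w) [::].

Lemma wpowSr (T : Type) n (w : seq T) : wpow n.+1 w = wpow n w ++ w.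
Proof.
elim: n => [|n IH]; first by rewrite /wpow /= cats0.
have -> : wpow n.+2 w = w ++ wpow n.+1 w by [].
by rewrite {1}IH catA.
Qed.

Lemma rev_wpow (T : Type) n (w : seq T) : rev (wpow n w) = wpow n (rev w).
Proof. by elim: n => // n IH; rewrite wpowSr rev_cat IH. Qed.

Section Projections.
Variables (Sigma : finType) (N : nat) (P : Sigma -> 'M[C]_N).
Hypothesis PP : forall c, P c *m P c = P c.
Hypothesis adjP : forall c, adjmx (P c) = P c.
Implicit Types (x y w a : seq Sigma) (M : 'M[C]_N) (e : C).

Fixpoint Pw x : 'M[C]_N := if x is c :: x' then P c *m Pw x' else 1%:M.

Lemma Pw_cat x y : Pw (x ++ y) = Pw x *m Pw y.
Proof. by elim: x => [|c x IH] /=; rewrite ?mul1mx // IH mulmxA. Qed.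

Lemma adj_Pw x : adjmx (Pw x) = Pw (rev x).
Proof.
elim: x => [|c x IH]; first exact: adjmx1.
by rewrite rev_cons -cats1 Pw_cat /= mulmx1 adjmxM IH adjP.
Qed.

Lemma frob_P M c : frob (M *m P c) <= frob M.
Proof. by rewrite (frob_proj M (PP c) (adjP c)) lerDl frob_ge0. Qed.

Lemma frob_Pw M x : frob (M *m Pw x) <= frob M.
Proof.
elim: x M => [|c x IH] M /=; first by rewrite mulmx1.
by rewrite mulmxA; apply: le_trans (IH _) (frob_P _ _).
Qed.

(** Each product has squared Frobenius norm at most N <= (N + 1)^2, so its N^2 entries are bounded
    by N + 1. *)
Definition Kbound : C := (N * N)%:R * N.+1%:R.

Lemma Kbound_ge0 : 0 <= Kbound.
Proof. by rewrite mulr_ge0. Qed.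

Lemma l1_Pw x : l1 (Pw x) <= Kbound.
Proof.
apply: l1_frob => //; rewrite -[Pw x]mul1mx; apply: le_trans (frob_Pw _ _) _.
by rewrite /frob mul1mx adjmx1 mxtrace1 -natrX ler_nat; nia.
Qed.

Lemma l1_P c : l1 (P c) <= Kbound.
Proof. by have := l1_Pw [:: c]; rewrite /= mulmx1. Qed.

(** Together the letters lose at most e^2 of squared norm. By Pythagoras each step moves the current
    matrix by at most N^2 e in [l1]; the triangle inequality adds the steps up. *)
Lemma l1_prefix M e x y : 0 <= e -> frob M - frob (M *m Pw (x ++ y)) <= e ^+ 2 ->
  l1 (M - M *m Pw x) <= (size x)%:R * ((N * N)%:R * e).
Proof.
move=> e0; elim: x M => [|c x IH] M h; first by rewrite mulmx1 subrr l1_0 mul0r.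
rewrite /= !mulmxA in h *; set M' := M *m P c in h *.
have -> : M - M' *m Pw x = (M - M') + (M' - M' *m Pw x) by rewrite addrA subrK.
apply: le_trans (l1D _ _) _; rewrite -nat1r mulrDl mul1r; apply: lerD.
  apply: l1_frob => //; apply: le_trans h.
  rewrite (frob_proj M (PP c) (adjP c)) -/M' addrAC lerDr subr_ge0.
  exact: frob_Pw.
by apply: IH; apply: le_trans h; rewrite lerD2r; apply: frob_P.
Qed.

(* Pythagoras bounds each single step by the total loss of norm along [w];
   hence a matrix whose norm [w] hardly decreases is almost fixed by every
   letter of [w]. *)
Lemma l1_letter M e w c : 0 <= e -> frob M - frob (M *m Pw w) <= e ^+ 2 ->
  c \in w -> l1 (M - M *m P c) <= (size w)%:R * ((N * N)%:R * e) * (1 + Kbound).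
Proof.
move=> e0 h /splitPr ew; case: ew h => w1 w2 h.
(* X is fixed exactly by [P c] and, by [l1_prefix], close to M. *)
set X := M *m Pw (w1 ++ [:: c]).
have Xc : X *m P c = X by rewrite /X -mulmxA Pw_cat -mulmxA /= mulmx1 PP.
have lX : l1 (M - X) <= (size (w1 ++ c :: w2))%:R * ((N * N)%:R * e).
  apply: le_trans (@l1_prefix _ _ _ w2 e0 _) _; first by rewrite -catA.
  rewrite ler_wpM2r ?mulr_ge0 // ler_nat !size_cat /=; lia.
have -> : M - M *m P c = (M - X) + (X - M) *m P c.
  by rewrite mulmxBl Xc addrA subrK.
apply: le_trans (l1D _ _) _; rewrite mulrDr mulr1; apply: lerD => //.
apply: le_trans (l1M _ _) _; rewrite l1_dist.
by apply: ler_pM; rewrite ?l1_ge0 ?l1_P.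
Qed.

Lemma l1_absorb w a : {subset a <= w} -> exists2 k : C, 0 <= k &
  forall M e, 0 <= e -> frob M - frob (M *m Pw w) <= e ^+ 2 ->
    l1 (M - M *m Pw a) <= k * e.
Proof.
elim: a => [|c a IH] sub.
  by exists 0 => // M e e0 h; rewrite mulmx1 subrr l1_0 mul0r.
have [|k k0 hk] := IH; first by move=> b ba; apply: sub; rewrite inE ba orbT.
have cw : c \in w by apply: sub; rewrite mem_head.
pose d := (size w)%:R * (N * N)%:R * (1 + Kbound) * Kbound.
have d0 : 0 <= d by rewrite !mulr_ge0 ?addr_ge0 ?Kbound_ge0.
exists (d + k) => [|M e e0 h]; first exact: addr_ge0.
have -> : M - M *m Pw (c :: a) = (M - M *m P c) *m Pw a + (M - M *m Pw a).
  by rewrite [Pw _]/= mulmxBl -mulmxA [RHS]addrC addrA subrK.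
apply: le_trans (l1D _ _) _; rewrite mulrDl; apply: lerD; last exact: hk.
apply: le_trans (l1M _ _) _.
have -> : d * e = (size w)%:R * ((N * N)%:R * e) * (1 + Kbound) * Kbound.
  by rewrite /d; ring.
by apply: ler_pM; rewrite ?l1_ge0 ?l1_Pw // (l1_letter e0 h).
Qed.

(** The adjoint turns left absorption into right absorption for reversed words. Applying
    [small_descent] to the sum of both norms gives one exponent n for both sides. *)
Lemma l1_power_absorb w a v b : {subset a <= w} -> {subset b <= v} ->
  forall e, 0 < e -> exists n,
    l1 (Pw (wpow n w) - Pw a *m Pw (wpow n w)) <= e /\
    l1 (Pw (wpow n v) - Pw (wpow n v) *m Pw b) <= e.
Proof.
move=> sa sb e e0.
have [|k k0 hk] := @l1_absorb (rev w) (rev a).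
  by move=> c; rewrite !mem_rev; apply: sa.
have [k' k'0 hk'] := l1_absorb sb.
have kk0 : 0 < k + k' + 1 by rewrite ltr_wpDl ?addr_ge0.
pose e' := e / (k + k' + 1).
have e'0 : 0 < e' by rewrite divr_gt0.
have e'k : e' * (k + k' + 1) = e by rewrite divfK // gt_eqF.
pose F1 n := frob (Pw (wpow n (rev w))); pose F2 n := frob (Pw (wpow n v)).
have dec u n : frob (Pw (wpow n.+1 u)) = frob (Pw (wpow n u) *m Pw u).
  by rewrite wpowSr Pw_cat.
have [|n hn] := @small_descent (fun n => F1 n + F2 n) (e' ^+ 2) _ (exprn_gt0 _ e'0).
  by move=> n; rewrite addr_ge0 ?frob_ge0.
have d1 : 0 <= F1 n - F1 n.+1 by rewrite subr_ge0 /F1 dec frob_Pw.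
have d2 : 0 <= F2 n - F2 n.+1 by rewrite subr_ge0 /F2 dec frob_Pw.
have hn' : (F1 n - F1 n.+1) + (F2 n - F2 n.+1) <= e' ^+ 2.
  by move: hn; rewrite opprD addrACA.
exists n; split.
  rewrite -l1_adj adjmxB adjmxM !adj_Pw rev_wpow.
  apply: (@le_trans _ _ (k * e')); last first.
    by rewrite -e'k mulrC ler_pM2l // -addrA lerDl addr_ge0.
  apply: hk; first exact: ltW.
  by rewrite -dec; apply: le_trans hn'; rewrite lerDl.
apply: (@le_trans _ _ (k' * e')); last first.
  by rewrite -e'k mulrC ler_pM2l // [k + k']addrC -addrA lerDl addr_ge0.
apply: hk'; first exact: ltW.
by rewrite -dec; apply: le_trans hn'; rewrite lerDr.
Qed.

End Projections.

(** * Finite index from boundedness *)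

Lemma grid_real (B eta : C) : 0 <= B -> 0 < eta ->
  exists (m : nat) (g : C -> 'I_m.+1), forall r r' : C,
    r \is Num.real -> r' \is Num.real -> `|r| <= B -> `|r'| <= B ->
    g r = g r' -> `|r - r'| <= eta.
Proof.
move=> B0 eta0.
have [m hm] : exists m : nat, (B + B) / eta < m%:R.
  by apply: C_archimedean; rewrite divr_ge0 ?addr_ge0 // ltW.
exists m.
(* Index of the cell of length eta containing r + B, with cell 0 as default outside the range. *)
have /choice [g hg] r : exists k : 'I_m.+1, r \is Num.real -> `|r| <= B ->
    k%:R <= (r + B) / eta < k.+1%:R.
  have [rr|] := boolP (r \is Num.real); last by exists ord0.
  have [rB|] := boolP (`|r| <= B); last by exists ord0.
  have /andP [r1 r2] : - B <= r <= B by rewrite -real_ler_norml.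
  have z0 : 0 <= (r + B) / eta.
    by rewrite divr_ge0 ?(ltW eta0) // -lerBlDr sub0r.
  have ex : exists k : nat, (r + B) / eta < k.+1%:R.
    have [k hk] := C_archimedean z0; exists k; apply: lt_trans hk _.
    by rewrite ltr_nat.
  case: (ex_minnP ex) => k hk kmin.
  have zm : (r + B) / eta < m%:R.
    by apply: le_lt_trans hm; rewrite ler_pM2r ?invr_gt0 // lerD2r.
  have kz : k%:R <= (r + B) / eta.
    case: k hk kmin => [//|k] hk kmin.
    rewrite real_leNgt ?ger0_real //; apply/negP => /kmin; lia.
  have km : (k < m.+1)%N.
    by have := le_lt_trans kz zm; rewrite ltr_nat; lia.
  by exists (Ordinal km) => _ _; rewrite kz.
exists g => r r' rr rr' rB rB' e.
have /andP [a1 a2] := hg r rr rB; have /andP [b1 b2] := hg r' rr' rB'.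
rewrite e in a1 a2.
set u := (r + B) / eta in a1 a2; set v := (r' + B) / eta in b1 b2.
have ur : u \is Num.real by apply/ger0_real/le_trans/a1.
have vr : v \is Num.real by apply/ger0_real/le_trans/b1.
have -> : r - r' = (u - v) * eta.
  by rewrite mulrBl !divfK ?gt_eqF // opprD addrACA subrr addr0.
rewrite normrM (gtr0_norm eta0) -[leRHS]mul1r ler_pM2r //.
rewrite real_ler_norml ?realB // lerBlDr lerNl opprB lerBlDr.
rewrite -nat1r in a2 b2.
by rewrite (le_trans (ltW b2)) ?lerD2l // (le_trans (ltW a2)) // lerD2l.
Qed.

Lemma grid (B eta : C) : 0 <= B -> 0 < eta ->
  exists (G : finType) (g : C -> G), forall z z' : C,
    `|z| <= B -> `|z'| <= B -> g z = g z' -> `|z - z'| <= eta.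
Proof.
move=> B0 eta0; have eta2 : 0 < eta / 2%:R by rewrite divr_gt0.
have [m [g hg]] := grid_real B0 eta2.
exists ('I_m.+1 * 'I_m.+1)%type, (fun z => (g ('Re z), g ('Im z))) => z z' hz hz' [e1 e2].
have nRe (u : C) : `|'Re u| <= `|u| by have [] := leif_normC_Re_Creal u.
have nIm (u : C) : `|'Im u| <= `|u|.
  rewrite -(@ler_pXn2r _ 2) ?nnegrE // (normC2_Re_Im u).
  by rewrite real_normK ?Creal_Im // lerDr real_exprn_even_ge0 ?Creal_Re.
have -> : z - z' = ('Re z - 'Re z') + 'i * ('Im z - 'Im z').
  by rewrite {1}[z]Crect {1}[z']Crect mulrBr opprD addrACA.
apply: le_trans (ler_normD _ _) _; rewrite normrM normCi mul1r.
have -> : eta = eta / 2%:R + eta / 2%:R by field.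
by apply: lerD; apply: hg; rewrite ?Creal_Re ?Creal_Im ?(le_trans (nRe _)) ?(le_trans (nIm _)).
Qed.

(** As h need not be compatible with appending letters, transitions pass through a chosen
    representative of each value. *)
Lemma regular_of_index (Sigma : finType) (L : language Sigma) (Q : finType)
    (h : seq Sigma -> Q) :
  (forall x y, h x = h y -> forall z, L (x ++ z) -> L (y ++ z)) -> regular L.
Proof.
move=> hL.
have /choice [rep hrep] q : exists x, (exists y, h y = q) -> h x = q.
  by have [[y hy]|nex] := pselect (exists y, h y = q); [exists y | exists [::]].
have repK y : h (rep (h y)) = h y by apply: hrep; exists y.
pose d q s := h (rcons (rep q) s).
exists Q, (h [::]), d, (fun q => `[< L (rep q) >]) => w.
suff gen z : L (w ++ z) <-> L (rep (foldl d (h [::]) w) ++ z).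
  by have := gen [::]; rewrite !cats0 => ->; split => /asboolP.
elim/last_ind: w z => [|w s IH] z.
  by split; apply: (hL); rewrite repK.
rewrite cat_rcons IH foldl_rcons -cat_rcons {3}/d.
by split; apply: (hL); rewrite repK.
Qed.

(** * Isolated cut-points for products of projections *)

Section IsolatedProjections.
Variables (Sigma : finType) (N : nat) (P : Sigma -> 'M[C]_N).
Hypothesis PP : forall c, P c *m P c = P c.
Hypothesis adjP : forall c, adjmx (P c) = P c.
Variables (xi : 'rV[C]_N) (eta : 'cV[C]_N) (L : language Sigma) (delta : C).
Let p x := (xi *m Pw P x *m eta) 0 0.
Hypothesis delta_gt0 : 0 < delta.
Hypothesis sep : forall x y, `|p x - p y| < delta -> L x -> L y.

Let K := Kbound N.
Let K0 : 0 <= K := Kbound_ge0 N.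

(** Applying P_z and then eta is Lipschitz for [l1] with a constant k independent of z; dividing by
    k + 1 keeps the divisor positive. *)
Lemma close_vectors : exists2 e : C, 0 < e &
  forall x y z, l1 (xi *m Pw P x - xi *m Pw P y) <= e -> L (x ++ z) -> L (y ++ z).
Proof.
pose k := K * l1 eta; have k0 : 0 <= k by rewrite mulr_ge0 ?l1_ge0.
have k1 : 0 < k + 1 by rewrite ltr_wpDl.
exists (delta / (k + 1)) => [|x y z le]; first exact: divr_gt0.
apply: sep; rewrite /p !Pw_cat !mulmxA.
set v := xi *m Pw P x in le *; set v' := xi *m Pw P y in le *.
have -> : (v *m Pw P z *m eta) 0 0 - (v' *m Pw P z *m eta) 0 0 =
    ((v - v') *m (Pw P z *m eta)) 0 0 by rewrite !mulmxBl !mulmxA !mxE.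
apply: le_lt_trans (entry_l1 _ _ _) _; apply: le_lt_trans (l1M _ _) _.
apply: (@le_lt_trans _ _ (delta / (k + 1) * k)).
  apply: ler_pM; rewrite ?l1_ge0 //; apply: le_trans (l1M _ _) _.
  by apply: ler_wpM2r; rewrite ?l1_ge0 // l1_Pw.
by rewrite mulrAC ltr_pdivrMr // ltr_pM2l // ltrDl.
Qed.

Lemma close_syn_eq : exists2 e : C, 0 < e &
  forall u v, l1 (Pw P u - Pw P v) <= e -> syn_eq L u v.
Proof.
have [e e0 he] := close_vectors.
pose k := l1 xi * K; have k0 : 0 <= k by rewrite mulr_ge0 ?l1_ge0.
have k1 : 0 < k + 1 by rewrite ltr_wpDl.
exists (e / (k + 1)) => [|u v le x y]; first exact: divr_gt0.
have dist u' v' : l1 (Pw P u' - Pw P v') <= e / (k + 1) ->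
    L (x ++ u' ++ y) -> L (x ++ v' ++ y).
  move=> le'; rewrite !(catA x); apply: he; rewrite !Pw_cat !mulmxA -mulmxBr.
  apply: le_trans (l1M _ _) _; apply: (@le_trans _ _ (k * (e / (k + 1)))).
    apply: ler_pM; rewrite ?l1_ge0 //; apply: le_trans (l1M _ _) _.
    by apply: ler_wpM2l; rewrite ?l1_ge0 // l1_Pw.
  rewrite mulrCA ger_pMr // ler_pdivrMr // mul1r lerDl; exact: ler01.
by split; apply: dist => //; rewrite l1_dist.
Qed.

Lemma isolated_regular : regular L.
Proof.
have [e e0 he] := close_vectors.
have N1 : 0 < N.+1%:R :> C by rewrite ltr0n.
(* Mesh e/(N + 1) in each of the N coordinates keeps the [l1] distance within e. *)
have [|G [g hg]] := @grid (l1 xi * K) (e / N.+1%:R) _ (divr_gt0 e0 N1).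
  by rewrite mulr_ge0 ?l1_ge0.
apply: (@regular_of_index _ _ {ffun 'I_N -> G}
  (fun x => [ffun j => g ((xi *m Pw P x) 0 j)])).
move=> x y /ffunP exy z; apply: he.
have bnd w j : `|(xi *m Pw P w) 0 j| <= l1 xi * K.
  apply: le_trans (entry_l1 _ _ _) _; apply: le_trans (l1M _ _) _.
  by apply: ler_wpM2l; rewrite ?l1_ge0 // l1_Pw.
apply: (@le_trans _ _ ((1 * N)%:R * (e / N.+1%:R))).
  apply: l1_entry => i j; rewrite !ord1.
  have subE (A B : 'rV[C]_N) : (A - B) 0 j = A 0 j - B 0 j by rewrite !mxE.
  rewrite subE.
  by apply: hg => //; have := exy j; rewrite !ffunE.
rewrite mul1n mulrCA ger_pMr // ler_pdivrMr // mul1r ler_nat; exact: leqnSn.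
Qed.

Lemma isolated_idem c : syn_eq L [:: c; c] [:: c].
Proof.
have [e e0 he] := close_syn_eq; apply: he.
by rewrite /= mulmx1 PP subrr l1_0 ltW.
Qed.

Lemma syn_eq_pump u a b n : syn_eq L u (a ++ u ++ b) ->
  syn_eq L u (wpow n a ++ u ++ wpow n b).
Proof.
move=> h; elim: n => [|n IH]; first by rewrite cats0.
apply: syn_eq_trans IH _.
have := syn_eq_catl (wpow n a) (syn_eq_catr (wpow n b) h).
by rewrite wpowSr -!catA.
Qed.

Lemma isolated_Jtrivial : synJtrivial L.
Proof.
move=> u v huv.
have [a [b vu]] : exists a b, syn_eq L v (a ++ u ++ b).
  by apply/huv; exists [::], [::]; rewrite cats0; apply: syn_eq_refl.
have [c [d uv]] : exists c d, syn_eq L u (c ++ v ++ d).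
  by apply/huv; exists [::], [::]; rewrite cats0; apply: syn_eq_refl.
apply: syn_eq_trans (syn_eq_sym vu).
have uu : syn_eq L u ((c ++ a) ++ u ++ (b ++ d)).
  apply: syn_eq_trans uv _.
  by have := syn_eq_catl c (syn_eq_catr d vu); rewrite -!catA.
have [e e0 he] := close_syn_eq.
(* Each of the two absorption errors gets multiplied by at most K, hence the target e/(2K + 1). *)
have k1 : 0 < K + K + 1 by rewrite ltr_wpDl ?addr_ge0.
have [||n [h1 h2]] := @l1_power_absorb _ _ _ PP adjP (c ++ a) a (b ++ d) b _ _
  (e / (K + K + 1)) (divr_gt0 e0 k1).
- by move=> s sa; rewrite mem_cat sa orbT.
- by move=> s sb; rewrite mem_cat sb.
set W := wpow n (c ++ a) in h1; set V := wpow n (b ++ d) in h2.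
have uWV : syn_eq L u (W ++ u ++ V) by apply: syn_eq_pump.
apply: syn_eq_trans uWV _.
apply: (@syn_eq_trans _ _ _ (a ++ (W ++ u ++ V) ++ b)); last first.
  by apply/syn_eq_catl/syn_eq_catr/syn_eq_sym/syn_eq_pump.
apply: he; rewrite !Pw_cat.
(* Telescoping: first a is inserted in front of W, then b behind V. *)
have -> : Pw P W *m (Pw P u *m Pw P V) -
    Pw P a *m (Pw P W *m (Pw P u *m Pw P V) *m Pw P b) =
  (Pw P W - Pw P a *m Pw P W) *m Pw P (u ++ V) +
    Pw P (a ++ W ++ u) *m (Pw P V - Pw P V *m Pw P b).
  by rewrite mulmxBr mulmxBl !Pw_cat !mulmxA addrA subrK.
apply: le_trans (l1D _ _) _.
apply: (@le_trans _ _ (e / (K + K + 1) * K + K * (e / (K + K + 1)))).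
  by apply: lerD; apply: le_trans (l1M _ _) _; apply: ler_pM;
    rewrite ?l1_ge0 ?l1_Pw.
rewrite [K * _]mulrC -mulrDr mulrAC ler_pdivrMr // ler_pM2l // lerDl; exact: ler01.
Qed.

End IsolatedProjections.

Lemma uniq_map_inj_in (T1 T2 : eqType) (f : T1 -> T2) s :
  uniq (map f s) -> {in s &, injective f}.
Proof.
elim: s => //= z s IH /andP [nz us] x y; rewrite !inE.
move=> /orP [/eqP ->|xs] /orP [/eqP ->|ys] // e; last exact: IH e.
  by rewrite e map_f in nz.
by rewrite -e map_f in nz.
Qed.

(** * Measurements as orthogonal projections of the space of matrices *)

Section MeasureSuperoperator.
Variables (m : nat) (O : observable m).
Implicit Types rho : 'M[C]_m.

Fact measure_is_linear : linear (measure O).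
Proof.
move=> c A B; rewrite /measure scaler_sumr -big_split; apply: eq_bigr => rp _.
by rewrite mulmxDr mulmxDl -scalemxAr -scalemxAl.
Qed.

HB.instance Definition _ :=
  GRing.isLinear.Build C 'M[C]_m 'M[C]_m _ (measure O) measure_is_linear.

Lemma measure_idem rho : measure O (measure O rho) = measure O rho.
Proof.
rewrite /measure; apply: eq_big_seq => rp rpO; have [P2 _ _] := obs_proj rpO.
rewrite mulmx_sumr mulmx_suml.
transitivity (\sum_(rq <- obs_spec O) rp.2 *m rq.2 *m rho *m rp.2).
  apply: eq_big_seq => rq rqO; rewrite !mulmxA.
  have [e|ne] := eqVneq rp.1 rq.1.
    by rewrite -(uniq_map_inj_in (obs_uniq O) rpO rqO e) -!mulmxA !P2.
  by rewrite (obs_orth rpO rqO ne) !mul0mx.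
by rewrite -!mulmx_suml -mulmx_sumr obs_sum mulmx1.
Qed.

Lemma adjmx_measure rho : adjmx (measure O rho) = measure O (adjmx rho).
Proof.
rewrite /measure adjmx_sum; apply: eq_big_seq => rp /obs_proj [_ aP _].
by rewrite !adjmxM aP mulmxA.
Qed.

Definition measure_mx : 'M[C]_(m * m) := lin_mx (measure O).

Lemma mxvec_measure rho : mxvec rho *m measure_mx = mxvec (measure O rho).
Proof. exact: mul_vec_lin. Qed.

Lemma measure_mx_idem : measure_mx *m measure_mx = measure_mx.
Proof.
apply/row_matrixP => i; rewrite !rowE mulmxA -['e_i]vec_mxK.
by rewrite !mxvec_measure measure_idem.
Qed.

Lemma measure_mxE k l k' l' :
  measure_mx (mxvec_index k l) (mxvec_index k' l') =
  \sum_(rp <- obs_spec O) rp.2 k' k * rp.2 l l'.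
Proof.
have -> : measure_mx (mxvec_index k l) (mxvec_index k' l') = measure O (delta_mx k l) k' l'.
  by rewrite -[RHS]mxvecE -vec_mx_delta -mxvec_measure vec_mxK -rowE [RHS]mxE.
rewrite /measure summxE; apply: eq_bigr => rp _.
rewrite -(mul_delta_mx (0 : 'I_1)) mulmxA -colE -mulmxA -rowE mxE big_ord1 !mxE.
by [].
Qed.

Lemma adj_measure_mx : adjmx measure_mx = measure_mx.
Proof.
apply/matrixP => i j; rewrite adjmxE.
case/mxvec_indexP: i => k l; case/mxvec_indexP: j => k' l'.
rewrite !measure_mxE rmorph_sum; apply: eq_big_seq => rp /obs_proj [_ aP _].
have cP i j : (rp.2 i j)^* = rp.2 j i by rewrite -adjmxE aP.
by rewrite rmorphM; congr (_ * _); apply: cP.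
Qed.

End MeasureSuperoperator.

(** The order of [C] is partial, so comparison with the cut-point requires real values; traces of
    products of two Hermitian matrices are real. *)
Lemma accprob_real (Sigma : finType) (A : mon1qfa Sigma) x :
  accprob A x \is Num.real.
Proof.
have adj_rho : adjmx (rho_word A x) = rho_word A x.
  elim/last_ind: x => [|x c IH]; first by rewrite /rho_word /= /rho0 adjmxM adjmxK.
  by rewrite /rho_word foldl_rcons -/(rho_word A x) adjmx_measure IH.
rewrite /accprob big_seq_cond; apply: rpred_sum => rp /andP [/obs_proj [_ aP _] _].
apply/CrealP; set X := rp.2 *m _.
transitivity (\tr (adjmx X)).
  by rewrite /mxtrace rmorph_sum; apply: eq_bigr => i _; rewrite adjmxE.
by rewrite /X adjmxM aP adj_rho mxtrace_mulC.
Qed.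

Lemma LMO_VJbar (Sigma : finType) (L : language Sigma) : LMO L -> VJbar L.
Proof.
case=> A [lam [lam_real [hL [d d0 hd]]]].
pose N := (qdim A * qdim A)%N.
pose P c := measure_mx (qobs A (Some c)).
have PP c : P c *m P c = P c by apply: measure_mx_idem.
have adjP c : adjmx (P c) = P c by apply: adj_measure_mx.
pose E := \sum_(rp <- obs_spec (qobs A None) | rp.1 \in qacc A) rp.2.
(* The trace of E rho is the sum of the rho_kl E_lk, so E enters the final vector transposed. *)
pose xi := mxvec (rho0 A); pose eta : 'cV[C]_N := (mxvec E^T)^T.
have rhoE x : xi *m Pw P x = mxvec (rho_word A x).
  elim/last_ind: x => [|x c IH]; first by rewrite mulmx1.
  rewrite -cats1 Pw_cat mulmxA IH [Pw _ _]/= mulmx1 mxvec_measure.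
  by rewrite /rho_word foldl_cat.
have accE x : (xi *m Pw P x *m eta) 0 0 = accprob A x.
  rewrite rhoE /accprob.
  transitivity (\tr (E *m rho_word A x)); last first.
    by rewrite mulmx_suml raddf_sum.
  rewrite mxE (reindex _ (curry_mxvec_bij _ _)) /mxtrace.
  transitivity (\sum_j (rho_word A x j.1 j.2 * E j.2 j.1)).
    apply: eq_bigr => -[k l] _; rewrite [uncurry _ _]/= mxvecE; congr (_ * _).
    by rewrite mxE mxvecE mxE.
  rewrite -(pair_bigA _ (fun k l => rho_word A x k l * E l k)) exchange_big.
  by apply: eq_bigr => i _; rewrite mxE; apply: eq_bigr => k _; rewrite mulrC.
(* With x in L and y outside, y has probability at most [lam] and x at least [lam + d]. *)
have gap x y : `|accprob A x - accprob A y| < d -> L x -> L y.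
  move=> lt /hL Lx; apply/hL; rewrite real_ltNge ?accprob_real //.
  apply/negP => le.
  have h1 := hd x; rewrite ger0_norm ?subr_ge0 ?(ltW Lx) // in h1.
  have h2 : d <= accprob A x - accprob A y by apply: le_trans h1 _; rewrite lerD2l lerN2.
  have := lt_le_trans lt h2; rewrite ger0_norm ?ltxx //.
  by apply: le_trans h2; apply: ltW.
have sep x y : `|(xi *m Pw P x *m eta) 0 0 - (xi *m Pw P y *m eta) 0 0| < d ->
  L x -> L y by rewrite !accE; apply: gap.
split.
- exact: (isolated_regular PP adjP d0 sep).
- exact: (isolated_Jtrivial PP adjP d0 sep).
- exact: (isolated_idem PP adjP d0 sep).
Qed.

Theorem theorem6 (Sigma : finType) (L : language Sigma) :
  (LMO L <-> VJbar L) /\ (VJbar L <-> liIdPT L).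
Proof.
have back : liIdPT L -> LMO L.
  case=> L' gen e; apply: (@avg_recognizable_LMO _ L).
  apply: avg_recognizable_ext (avg_recognizable_liIdPT C gen) => w.
  by rewrite e.
split; split.
- exact: LMO_VJbar.
- by move=> /VJbar_liIdPT /back.
- exact: VJbar_liIdPT.
- by move=> /back /LMO_VJbar.
Qed.
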